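(* Let $g\in\mathcal H$ be such that $\lambda_0(g)<\lambda_\infty(g)$. Assume that for some $K\Subset X$ there exists a strictly positive function $u\in\mathcal F(X)$ satisfying $$Q'[u]-\lambda_0(g)\,|g|\,|u|^{p-2}u=0\quad\text{in }X\setminus K$$ and such that $c_-\in\ell^1(X,|u|^p)$, i.e. $\sum_X c_-|u|^p<\infty$. Then $\|g\|_{\mathcal H}$ is attained in $\mathcal D_0(X)$, i.e. there is $f\in\mathcal D_0(X)$, $f\neq0$, such that $$\|g\|_{\mathcal H}\,Q(f)=\sum_X m|g||f|^p .$$
   Context: Setting: $p\in(1,\infty)$; $X$ is an infinite countable set with the discrete topology, and $K\Subset X$ means that $K$ is a finite subset of $X$. $m:X\to(0,\infty)$ is a measure of full support. $C(X)$ is the set of all functions $X\to\mathbb{R}$ and $C_c(X)$ the set of finitely supported ones; $C_c(X\setminus K)$ denotes those elements of $C_c(X)$ supported in $X\setminus K$. $b:X\times X\to[0,\infty)$ is a connected graph over $(X,m)$: symmetric, zero diagonal, $\sum_{y}b(x,y)<\infty$ for all $x$, and any two vertices are joined by a finite path along which $b>0$. $c:X\to\mathbb{R}$ is a potential, $c_\pm=(\pm c)\vee0$. Write $\nabla_{xy}f=f(x)-f(y)$. The energy functional is $$Q(\varphi)=\tfrac12\sum_{x,y\in X}b(x,y)|\nabla_{xy}\varphi|^p+\sum_{x\in X}c(x)|\varphi(x)|^p,\quad \varphi\in C_c(X),$$ and it is assumed that $Q\ge0$ on $C_c(X)$. Let $\mathcal F(X)=\{f\in C(X): \sum_y b(x,y)|\nabla_{xy}f|^{p-1}<\infty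 \text{ for all }x\}$ and, for $f\in\mathcal F(X)$, $$Q'[f](x)=\frac1{m(x)}\sum_{y}b(x,y)|\nabla_{xy}f|^{p-2}\nabla_{xy}f+\frac{c(x)}{m(x)}|f(x)|^{p-2}f(x)$$ (with $|0|^{p-2}0=0$). The space of Hardy weights is $\mathcal H=\{g\in C(X):\exists\,C>0\ \forall\varphi\in C_c(X):\ C\sum_X m|g||\varphi|^p\le Q(\varphi)\}$. For $g\in\mathcal H$, $$\|g\|_{\mathcal H}=\sup_{\varphi\in C_c(X),\,Q(\varphi)\ne0}\frac{\sum_X m|g||\varphi|^p}{Q(\varphi)},\qquad \|g\|_{\mathcal H,\partial X}=\inf_{K\Subset X}\ \sup_{\varphi\in C_c(X\setminus K),\,Q(\varphi)\ne0}\frac{\sum_X m|g||\varphi|^p}{Q(\varphi)},$$ $\lambda_0(g)=1/\|g\|_{\mathcal H}$ and $\lambda_\infty(g)=1/\|g\|_{\mathcal H,\partial X}$ (with $1/0=\infty$). Let $Q_+(f)=\frac12\sum_{x,y}b(x,y)|\nabla_{xy}f|^p+\sum_x c_+(x)|f(x)|^p$ and $\mathcal D(X)=\{f\in C(X):Q_+(f)<\infty\}$. $\mathcal D_0(X)$ is the space of all $f\in\mathcal D(X)$ for which there is a sequence $(\varphi_n)$ in $C_c(X)$ with $Q_+(\varphi_n-f)\to0$ and $\varphi_n\to f$ pointwise. If $\mathcal H\ne\{0\}$, then for $f\in\mathcal D_0(X)$ the series $\sum_X c|f|^p$ converges absolutely, and $Q(f)$ is defined by the same formula as on $C_c(X)$.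 *)

(* Defs.v *)
From HB Require Import structures.
From mathcomp Require Import all_boot all_order all_algebra.
From mathcomp Require Import all_classical all_reals all_analysis.

Set Implicit Arguments.
Unset Strict Implicit.
Unset Printing Implicit Defensive.

Import Order.TTheory GRing.Theory Num.Theory.
Import numFieldNormedType.Exports.

Local Open Scope classical_set_scope.
Local Open Scope ring_scope.

Section Defs.
Context {R : realType} {X : countType}.
Implicit Types (p : R) (m c f g : X -> R) (b : X -> X -> R) (K : set X).

(* Unordered sum of a real family; it is the usual sum as soon as the family is
   absolutely summable.  [esum] is only meaningful for nonnegative families,
   hence the splitting into positive and negative parts. *)
Definition usum (a : X -> R) : \bar R :=
  (\esum_(x in [set: X]) (a^\+ x)%:E - \esum_(x in [set: X]) (a^\- x)%:E)%E.

Definition connected_graph b : Prop :=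
  [/\ forall x y, 0 <= b x y,
      forall x y, b x y = b y x,
      forall x, b x x = 0,
      forall x, (\esum_(y in [set: X]) (b x y)%:E < +oo)%E
    & forall x y, exists s : seq X,
        path (fun v w => 0 < b v w) x s /\ last x s = y].

(* Finitely supported functions with support in [A]. *)
Definition Cc (A : set X) : set (X -> R) :=
  [set phi | finite_set [set x | phi x != 0] /\ [set x | phi x != 0] `<=` A].

Definition grad_energy p b f : \bar R :=
  (2^-1%:E *
   \esum_(e in [set: X * X]) (b e.1 e.2 * `|f e.1 - f e.2| `^ p)%:E)%E.

Definition energy p b c f : \bar R :=
  (grad_energy p b f + usum (fun x => c x * `|f x| `^ p)%R)%E.

Definition energy_plus p b c f : \bar R :=
  (grad_energy p b f + \esum_(x in [set: X]) (c^\+ x * `|f x| `^ p)%:E)%E.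

Definition formal_domain p b : set (X -> R) :=
  [set f | forall x,
     (\esum_(y in [set: X]) (b x y * `|f x - f y| `^ (p - 1))%:E < +oo)%E].

(* When [p < 2] the convention |0|^(p-2) 0 = 0 holds because of the second
   factor. *)
Definition schrodinger p m b c f (x : X) : \bar R :=
  ((m x)^-1%:E *
     usum (fun y => b x y * `|f x - f y| `^ (p - 2) * (f x - f y))%R
   + (c x / m x * `|f x| `^ (p - 2) * f x)%:E)%E.

Definition weighted p m g f : \bar R :=
  (\esum_(x in [set: X]) (m x * `|g x| * `|f x| `^ p)%:E)%E.

Definition hardy_weights p m b c : set (X -> R) :=
  [set g | exists C : R, 0 < C /\ forall phi, Cc [set: X] phi ->
     (C%:E * weighted p m g phi <= energy p b c phi)%E].

(* The supremum is taken in [0, +oo]; in particular it is 0 over the empty set,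
   whereas [ereal_sup set0] would be -oo. *)
Definition hardy_sup p m b c g (A : set X) : \bar R :=
  supremum 0%E [set (weighted p m g phi / energy p b c phi)%E |
    phi in [set phi | Cc A phi /\ energy p b c phi != 0%E]].

Definition hardy_norm p m b c g : \bar R := hardy_sup p m b c g [set: X].

Definition hardy_norm_infty p m b c g : \bar R :=
  ereal_inf [set hardy_sup p m b c g (~` K) | K in [set K | finite_set K]].

(* The extended inverse satisfies 0^-1 = +oo. *)
Definition lambda0 p m b c g : \bar R := ((hardy_norm p m b c g)^-1)%E.
Definition lambda_infty p m b c g : \bar R :=
  ((hardy_norm_infty p m b c g)^-1)%E.

Definition D p b c : set (X -> R) :=
  [set f | (energy_plus p b c f < +oo)%E].

Definition D0 p b c : set (X -> R) :=
  [set f | D p b c f /\ exists phi : nat -> X -> R,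
     [/\ forall n, Cc [set: X] (phi n),
         energy_plus p b c (phi n \- f) @[n --> \oo] --> 0%E
       & forall x, phi n x @[n --> \oo] --> f x]].

End Defs.

(* Main.v *)
(* Let [W = m |g|], [l = lambda_0 (g)] and [h = Q - l W], so that [h >= 0] on
   finitely supported functions.

   By the spectral gap, [Q >= l' W] with [l' > l] off a finite set [K].  Take
   [f >= 0] with [h f <= e W(f)].  Comparing [h] at [f] and at [f] doubled at a
   point [x] of [K] bounds [f x * sum_y b x y (f y)^(p-1)] by [(f x)^p] up to
   [e W(f)]; this is the error made in cutting [f] off on [K], so the gap gives
   [W(f) <= C sum_K f^p].  Hence [h] has a minimising sequence normalised on [K].

   Picone's inequality shows that replacing [f] by [v = min f u] does not
   increase [h] once [f <= u] on [K].  For functions below [u], cutting off on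
   [K] costs a bounded amount, so [W(v)], and since [c_- u^p] is summable also
   [Q_+ v], stay bounded.

   A pointwise limit [psi] of such [v] therefore lies in [D_0].  As [h >= 0] and
   [h v -> 0], domination by [u] yields [h psi <= h (psi + phi)] for all finitely
   supported [phi]; choosing [- phi] close to [psi] in [D_0] gives [h psi <= 0],
   while [h psi >= 0] follows from Fatou's lemma. *)

Require Import Defs.
From HB Require Import structures.
From mathcomp Require Import all_boot all_order all_algebra.
From mathcomp Require Import all_classical all_reals all_analysis.
From mathcomp Require Import ring lra.

Set Implicit Arguments.
Unset Strict Implicit.
Unset Printing Implicit Defensive.

Import Order.TTheory GRing.Theory Num.Theory.
Import numFieldNormedType.Exports.

Local Open Scope classical_set_scope.
Local Open Scope ring_scope.

(** * Powers *)

(** The potential of [h] has no fixed sign, so [h] need not be convex or lower semicontinuous under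
    pointwise convergence, and a minimising sequence might lose its mass at infinity. The bound by
    [u] is what repairs this. Since [u] lies in the formal domain, the row sums of
    [b x y * (u y)^(p-1)] are finite; as a finitely supported [phi] meets finitely many rows, the
    differences [h (v + phi) - h v] have a summable majorant and pass to the limit, although [h v]
    itself need not. The normalisation is that [v / u] sums to 1 over [K]. It forces [v <= u] on
    [K], so truncation leaves [K] alone, and it survives pointwise limits because [K] is finite, so
    the limit is nonzero. Membership in [D_0] requires approximation in energy; uniform convexity of
    [Q_+] provides it. Finally [h >= 0] is read as the Hardy inequality [l W + c_- <= Q_+] between
    nonnegative functionals, the form in which Fatou's lemma applies. *)

Section PowerInequalities.
Context {R : realType} (p : R).
Hypothesis p_gt1 : 1 < p.
Implicit Types a b r s t : R.

Let p_gt0 : 0 < p. Proof. exact: lt_trans p_gt1. Qed.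
Let p_neq0 : p != 0. Proof. by rewrite gt_eqF. Qed.
Let pB1_gt0 : 0 < p - 1. Proof. by rewrite subr_gt0. Qed.

(** Young's inequality for the product [r * 1], multiplied by [p]; [q] is the conjugate exponent. *)
Lemma bernoulli_powR r : 0 <= r -> 1 + p * (r - 1) <= r `^ p.
Proof.
move=> r0; pose q := p / (p - 1).
have q0 : 0 < q by rewrite divr_gt0.
have pq : p^-1 + q^-1 = 1 by rewrite /q; field; rewrite p_neq0 gt_eqF.
have := @conjugate_powR R r 1 p q r0 ler01 p_gt0 q0 pq.
rewrite powR1 mulr1 -(ler_pM2l p_gt0) mulrDr mulrCA divff// mulr1.
have -> : p * (1 / q) = p - 1 by rewrite /q; field; rewrite p_neq0 gt_eqF.
lra.
Qed.

(* For [r = s ^ 2] the bound follows by squaring the non-strict one for [s], as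
   [p < p ^ 2]. *)
Lemma bernoulli_powR_lt r : 0 <= r -> r != 1 -> 1 + p * (r - 1) < r `^ p.
Proof.
move=> r0 r1; set s := Num.sqrt r.
have s0 : 0 <= s by exact: sqrtr_ge0.
have rs : r = s * s by rewrite -expr2 sqr_sqrtr.
have s1 : 0 < (s - 1) ^+ 2.
  rewrite exprn_even_gt0//= subr_eq0; apply: contra r1 => /eqP s1.
  by rewrite rs s1 mulr1.
have rps : r `^ p = s `^ p * s `^ p by rewrite rs powRM.
have pp : 0 < p * (p - 1) * (s - 1) ^+ 2 by apply: mulr_gt0 => //; apply: mulr_gt0.
case: (leP 0 (1 + p * (s - 1))) => h.
  have := bernoulli_powR s0 => hs.
  have : (1 + p * (s - 1)) * (1 + p * (s - 1)) <= s `^ p * s `^ p.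
    by rewrite ler_pM.
  have -> : (1 + p * (s - 1)) * (1 + p * (s - 1)) =
    1 + p * (s * s - 1) + p * (p - 1) * (s - 1) ^+ 2 by ring.
  by rewrite rps rs; lra.
apply: lt_le_trans (powR_ge0 _ _).
have sl1 : p * (s - 1) < 0 by lra.
have := ler_wpM2l s0 (ltW sl1).
have -> : p * (r - 1) = p * (s - 1) + s * (p * (s - 1)) by rewrite rs; ring.
lra.
Qed.

Lemma powR_tangent a b : 0 <= a -> 0 <= b ->
  p * a `^ (p - 1) * (b - a) <= b `^ p - a `^ p.
Proof.
move=> a0 b0; have [->|a_neq0] := eqVneq a 0.
  by rewrite !powR0 ?gt_eqF// mulr0 mul0r subr0 powR_ge0.
have a_gt0 : 0 < a by rewrite lt_def a_neq0.
have := bernoulli_powR (divr_ge0 b0 a0).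
have ap := powR_gt0 p a_gt0.
rewrite -(ler_pM2r ap) -powRM ?divr_ge0// divfK//.
have -> : (1 + p * (b / a - 1)) * a `^ p = a `^ p + p * a `^ (p - 1) * (b - a).
  rewrite -(@mulr_powRB1 _ a p)//; field; exact: a_neq0.
lra.
Qed.

(** Jensen at the points [a / (1 - s)] and [b / s] with weights [1 - s] and [s]. The free parameter
    pays twice: [s = (a - b) / a] yields Picone's inequality, and small [s] gives an approximate
    triangle inequality whose first constant tends to 1. *)
Lemma powR_convex s a b : 0 < s -> s < 1 -> 0 <= a -> 0 <= b ->
  (a + b) `^ p <= (1 - s) `^ (1 - p) * a `^ p + s `^ (1 - p) * b `^ p.
Proof.
move=> s0 s1 a0 b0.
have split_pow t c : 0 < t -> 0 <= c -> t * (c / t) `^ p = t `^ (1 - p) * c `^ p.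
  move=> t0 c0; rewrite powRM ?invr_ge0 ?(ltW t0)//.
  rewrite -powR_inv1 ?(ltW t0)// -powRrM mulN1r mulrCA mulrC; congr (_ * _).
  by rewrite powRD ?(gt_eqF t0) ?implybT// powRr1// ltW.
have s1' : 0 < 1 - s by rewrite subr_gt0.
rewrite -!split_pow//.
set A := a / (1 - s); set B := b / s.
have A0 : 0 <= A by rewrite divr_ge0 ?(ltW s1').
have B0 : 0 <= B by rewrite divr_ge0 ?(ltW s0).
have -> : a + b = (1 - s) * A + s * B.
  by rewrite /A /B; field; rewrite !gt_eqF.
pose z := (1 - s) * A + s * B; rewrite -/z.
have z0 : 0 <= z by apply: addr_ge0; apply: mulr_ge0 => //; exact: ltW.
(* Both tangents are taken at the barycentre [z], so their linear terms cancel in the weighted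
   sum. *)
have := powR_tangent z0 A0; have := powR_tangent z0 B0.
rewrite -(ler_pM2l s0) => hB; rewrite -(ler_pM2l s1') => hA.
have : (1 - s) * (p * z `^ (p - 1) * (A - z)) +
    s * (p * z `^ (p - 1) * (B - z)) = 0 by rewrite /z; ring.
lra.
Qed.

Lemma powR_add_le q a b : 0 <= q -> 0 <= a -> 0 <= b ->
  (a + b) `^ q <= 2 `^ q * (a `^ q + b `^ q).
Proof.
move=> q0; wlog ab : a b / a <= b.
  by move=> h a0 b0; case: (leP a b) => ab; [|rewrite addrC (addrC (a `^ q))];
    apply: h => //; exact: ltW.
move=> a0 b0; apply: (@le_trans _ _ ((2 * b) `^ q)).
  by rewrite ge0_ler_powR ?nnegrE ?addr_ge0 ?mulr_ge0//; lra.
rewrite powRM// ler_wpM2l ?powR_ge0//.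
have := powR_ge0 a q; lra.
Qed.

(** A local Lipschitz bound. It gives continuity of [|t| ^ p] and, later, the majorants of energy
    differences. *)
Lemma powR_norm_increment a b :
  `| `|a + b| `^ p - `|a| `^ p | <= p * `|b| * (`|a| + `|b|) `^ (p - 1).
Proof.
have := ler_normD a b.
have : `|a| <= `|a + b| + `|b| by rewrite -{1}(addrK b a) -(normrN b) ler_normD.
move: (normr_ge0 a) (normr_ge0 b) (normr_ge0 (a + b)).
move: {a b}`|a| `|b| `|a + b| => A B D A0 B0 D0 ADB DAB.
have AB0 : 0 <= A + B by rewrite addr_ge0.
have mono x y : 0 <= x -> x <= y -> x `^ (p - 1) <= y `^ (p - 1).
  by move=> x0 xy; rewrite ge0_ler_powR ?nnegrE ?(ltW pB1_gt0)// (le_trans x0).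
rewrite ler_norml; apply/andP; split.
  have := powR_tangent A0 D0 => h.
  have m1 := mono _ _ A0 (eq_ind _ is_true B0 _ (esym (lerDl A B))).
  have : p * A `^ (p - 1) * (D - A) >= - (p * A `^ (p - 1) * B).
    by rewrite -mulrN ler_wpM2l ?mulr_ge0 ?powR_ge0 ?(ltW p_gt0)//; lra.
  have : p * A `^ (p - 1) * B <= p * B * (A + B) `^ (p - 1).
    rewrite mulrAC ler_wpM2l ?mulr_ge0 ?(ltW p_gt0)//; apply: mono => //; lra.
  lra.
have := powR_tangent AB0 A0.
have DAB' : D `^ p <= (A + B) `^ p.
  by rewrite ge0_ler_powR ?nnegrE ?(ltW p_gt0).
have -> : p * (A + B) `^ (p - 1) * (A - (A + B)) =
   - (p * B * (A + B) `^ (p - 1)) by ring.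
lra.
Qed.

(** Here [s] is the value at a vertex that is reset to 0 and [a] the value at a neighbour: the edge
    gains at most a term linear in [s]. *)
Lemma powR_sub_le s a : 0 <= s -> 0 <= a ->
  a `^ p - `|s - a| `^ p <= p * s * a `^ (p - 1).
Proof.
move=> s0 a0; have h := powR_tangent a0 (normr_ge0 (s - a)).
have : p * a `^ (p - 1) * (`|s - a| - a) >= p * a `^ (p - 1) * (- s).
  rewrite ler_wpM2l ?mulr_ge0 ?powR_ge0 ?(ltW p_gt0)//.
  have : a - s <= `|s - a| by rewrite distrC ler_norm.
  lra.
lra.
Qed.

(** If [a < 2 * s], every term is controlled by [s ^ p]. Otherwise doubling [s] moves it towards
    [a], and the edge loses at least [s * (a - s) ^ (p - 1)], where [a - s >= a / 2]. *)
Lemma powR_double_step s a : 0 <= s -> 0 <= a ->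
  `|2 * s - a| `^ p - `|s - a| `^ p <=
  (1 + 2 `^ p) * s `^ p - 2 `^ (1 - p) * (s * a `^ (p - 1)).
Proof.
move=> s0 a0.
have p10 := ltW pB1_gt0; have p0 := ltW p_gt0.
have two : (2 : R) `^ (1 - p) = (2 `^ (p - 1))^-1 by rewrite -powRN opprB.
have t0 : 0 < (2 : R) `^ (p - 1) by rewrite powR_gt0.
have key b : 0 <= b -> a <= 2 * b ->
    2 `^ (1 - p) * (s * a `^ (p - 1)) <= s * b `^ (p - 1).
  move=> b0 ab; rewrite two mulrCA ler_wpM2l// mulrC ler_pdivrMr//.
  rewrite mulrC -powRM// ge0_ler_powR ?nnegrE ?mulr_ge0//.
have sp0 := powR_ge0 s p.
have [as2|sa2] := ltP a (2 * s).
  have h1 : `|2 * s - a| `^ p <= (2 * s) `^ p.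
    rewrite ge0_ler_powR ?nnegrE ?mulr_ge0// ger0_norm; lra.
  rewrite powRM// in h1.
  have := key s s0 (ltW as2); rewrite mulr_powRB1// => h2.
  have := powR_ge0 `|s - a| p; lra.
have -> : `|2 * s - a| = a - 2 * s by rewrite distrC ger0_norm; lra.
have -> : `|s - a| = a - s by rewrite distrC ger0_norm; lra.
have as0 : 0 <= a - s by lra.
have as1 : 0 <= a - 2 * s by lra.
have h := @key (a - s) as0 ltac:(lra).
rewrite -(@mulr_powRB1 _ (a - 2 * s))// -(@mulr_powRB1 _ (a - s))//.
have : (a - 2 * s) * (a - 2 * s) `^ (p - 1) <= (a - 2 * s) * (a - s) `^ (p - 1).
  by rewrite ler_wpM2l// ge0_ler_powR ?nnegrE//; lra.
have : 0 <= (1 + 2 `^ p) * s `^ p by rewrite mulr_ge0// addr_ge0 ?powR_ge0.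
lra.
Qed.

(** Apply [powR_convex] with [s = (a - b) / a] to [F <= G + |F - G|]; multiplying by [s ^ (p - 1)]
    leaves exactly Picone's quotients. *)
Lemma picone_ordered F G a b : 0 <= F -> 0 <= G -> 0 < a -> 0 < b -> b <= a ->
  (a - b) `^ (p - 1) * (F `^ p / a `^ (p - 1) - G `^ p / b `^ (p - 1))
  <= `|F - G| `^ p.
Proof.
move=> F0 G0 a0 b0; rewrite le_eqVlt => /predU1P[->|ba].
  by rewrite subrr powR0 ?gt_eqF// mul0r powR_ge0.
have ab0 : 0 < a - b by lra.
pose s := (a - b) / a.
have s0 : 0 < s by rewrite divr_gt0.
have s1 : s < 1 by rewrite ltr_pdivrMr//; lra.
have FG : F <= G + `|F - G| by have := ler_norm (F - G); lra.
have : F `^ p <= (G + `|F - G|) `^ p.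
  by rewrite ge0_ler_powR ?nnegrE ?(ltW p_gt0)// addr_ge0.
move=> /le_trans /(_ (powR_convex s0 s1 G0 (normr_ge0 _))).
have pw t : 0 < t -> t `^ (1 - p) = (t `^ (p - 1))^-1.
  by move=> _; rewrite -powRN opprB.
have -> : 1 - s = b / a by rewrite /s; field; rewrite gt_eqF.
rewrite !pw ?divr_gt0// /s !powRM ?invr_ge0 ?(ltW a0) ?(ltW b0) ?(ltW ab0)//.
have -> : a^-1 `^ (p - 1) = (a `^ (p - 1))^-1.
  by rewrite -(powR_inv1 (ltW a0)) -powRrM mulN1r powRN.
have A0 := powR_gt0 (p - 1) a0; have B0 := powR_gt0 (p - 1) b0.
have C0 := powR_gt0 (p - 1) ab0.
move: A0 B0 C0; set A := a `^ _; set B := b `^ _; set C := (a - b) `^ _.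
move=> A0 B0 C0.
rewrite -(ler_pM2l (divr_gt0 C0 A0)).
have -> : C / A * ((B / A)^-1 * G `^ p + (C / A)^-1 * `|F - G| `^ p) =
  C / B * G `^ p + `|F - G| `^ p by field; rewrite !gt_eqF.
have -> : C * (F `^ p / A - G `^ p / B) = C / A * F `^ p - C / B * G `^ p by ring.
lra.
Qed.

Lemma continuous_powR_norm : continuous (fun t : R => `|t| `^ p).
Proof.
move=> a; apply/cvgrPdist_le => e e0.
pose L := p * (`|a| + 1) `^ (p - 1).
have L0 : 0 <= L by rewrite mulr_ge0 ?powR_ge0 ?(ltW p_gt0).
have d0 : 0 < Num.min 1 (e / (L + 1)).
  by rewrite lt_min ltr01 divr_gt0// ltr_pwDr.
near=> t.
have : `|a - t| <= Num.min 1 (e / (L + 1)).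
  near: t; exact: (@cvgrPdist_le _ _ _ _ _ id a).1 _ _ d0.
rewrite le_min => /andP[h1 h2].
rewrite distrC; have := powR_norm_increment a (t - a).
have -> : a + (t - a) = t by ring.
move=> /le_trans; apply.
rewrite distrC mulrAC.
apply: (@le_trans _ _ (L * `|a - t|)).
  rewrite /L ler_wpM2r// ler_wpM2l ?(ltW p_gt0)//.
  by rewrite ge0_ler_powR ?nnegrE ?(ltW pB1_gt0) ?addr_ge0// lerD2l.
move: h2; rewrite ler_pdivlMr ?ltr_pwDr// => h2.
have := normr_ge0 (a - t); nra.
Unshelve. all: by end_near. Qed.

Lemma cvg_powR_norm (f : nat -> R) (l : R) :
  f n @[n --> \oo] --> l -> `|f n| `^ p @[n --> \oo] --> `|l| `^ p.
Proof. by move=> fl; exact: (cvg_comp _ _ fl (@continuous_powR_norm l)). Qed.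

(** Passing to the modulus of [t] only increases the midpoint term. For [0 <= t < 1] strict
    Bernoulli is used at [1 / s] and [t / s], whose mean is 1; [t = -1] is treated apart. *)
Let midpoint_gap t : `|t| <= 1 -> t < 1 ->
  0 < (1 + `|t| `^ p) / 2 - `|(1 + t) / 2| `^ p.
Proof.
move=> t1 tlt1.
have absle : `|(1 + t) / 2| <= (1 + `|t|) / 2.
  rewrite normrM [`|2^-1|]ger0_norm// ler_wpM2r//.
  by rewrite (le_trans (ler_normD _ _))// normr1.
have [t_lt1|] := ltP `|t| 1; last first.
  move=> t_ge1; have tE : `|t| = 1 by apply/eqP; rewrite eq_le t1.
  have -> : t = -1.
    by move: tE tlt1; case: (ger0P t) => ? ? ?; lra.
  by rewrite subrr mul0r normr0 powR0// normrN1 powR1; lra.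
apply: (@lt_le_trans _ _ ((1 + `|t| `^ p) / 2 - ((1 + `|t|) / 2) `^ p)); last first.
  rewrite lerD2l lerN2 ge0_ler_powR ?nnegrE ?(ltW p_gt0)//.
move: (normr_ge0 t) t_lt1; move: {t t1 tlt1 absle}`|t| => t t0 t1.
set s := (1 + t) / 2; have s0 : 0 < s by rewrite /s; lra.
have sp := powR_gt0 p s0.
have h1 : s^-1 != 1 by rewrite invr_eq1 /s; apply/eqP; lra.
have h2 : t / s != 1.
  by apply/eqP => /(congr1 ( *%R^~ s)); rewrite divfK ?gt_eqF// mul1r /s; lra.
have si : 0 <= s^-1 by rewrite invr_ge0 ltW.
have := bernoulli_powR_lt si h1.

have := bernoulli_powR_lt (divr_ge0 t0 (ltW s0)) h2.
rewrite powRM ?invr_ge0 ?(ltW s0)//.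
have -> : s^-1 `^ p = (s `^ p)^-1.
  by rewrite -(powR_inv1 (ltW s0)) -powRrM mulN1r powRN.
rewrite -(ltr_pM2r sp) divfK ?gt_eqF// => h4.
rewrite -(ltr_pM2r sp) mulVf ?gt_eqF// => h3.
have : (1 + p * (t / s - 1)) * s `^ p + (1 + p * (s^-1 - 1)) * s `^ p =
    2 * s `^ p + p * ((t + 1) / s - 2) * s `^ p by ring.
have -> : (t + 1) / s = 2 by rewrite /s; field; apply/eqP; lra.
rewrite subrr mulr0 mul0r addr0; lra.
Qed.

(** This form of uniform convexity is additive, so it can be summed over edges and vertices. By
    homogeneity [a = 1] and [b = t] with [|t| <= 1]: near [t = 1] the term [e] suffices, and on the
    remaining compact interval the convexity defect has a positive minimum. *)
Lemma powR_uniform_convex e : 0 < e -> exists2 C, 0 <= C & forall a b,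
  `|a - b| `^ p <= e * (`|a| `^ p + `|b| `^ p) +
    C * ((`|a| `^ p + `|b| `^ p) / 2 - `|(a + b) / 2| `^ p).
Proof.
move=> e0; pose d t := (1 + `|t| `^ p) / 2 - `|(1 + t) / 2| `^ p.
have d_ge0 t : `|t| <= 1 -> 0 <= d t.
  move=> t1; have := t1; rewrite ler_norml => /andP[_].
  rewrite le_eqVlt => /predU1P[->|tl1]; last exact/ltW/midpoint_gap.
  by rewrite /d normr1 divff// normr1 !powR1 divff// subrr.
have dcont : continuous d.
  move=> t; apply: cvgB.
    by apply: cvgMr_tmp; apply: cvgD; [exact: cvg_cst|exact: continuous_powR_norm].
  suff aff : (1 + x) / 2 @[x --> t] --> (1 + t) / 2.
    exact: (cvg_comp _ _ aff (@continuous_powR_norm _)).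
  by apply: cvgMr_tmp; apply: cvgD; [exact: cvg_cst|exact: cvg_id].
pose h := e `^ p^-1.
have h0 : 0 < h by rewrite powR_gt0.
have hp : h `^ p = e by rewrite -powRrM mulVf// powRr1// ltW.
suff [C C0 HC] : exists2 C, 0 <= C & forall t, `|t| <= 1 ->
    `|1 - t| `^ p <= e + C * d t.
  exists C => // a b; wlog ba : a b / `|b| <= `|a|.
    move=> W; have [|/ltW ab] := leP `|b| `|a|; first exact: W.
    by rewrite distrC (addrC (`|a| `^ p)) (addrC a); exact: W.
  have [a0|a0] := eqVneq a 0.
    move: ba; rewrite a0 normr0 normr_le0 => /eqP ->.
    by rewrite subrr addr0 mul0r normr0 powR0// addr0 mul0r subrr !mulr0 addr0.
  have ap : 0 < `|a| by rewrite normr_gt0.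
  have := HC (b / a).
  rewrite normrM normfV ler_pdivrMr// mul1r => /(_ ba).
  have app := powR_gt0 p ap.
  rewrite -(ler_pM2r app) -powRM//.
  have -> : `|1 - b / a| * `|a| = `|a - b|.
    by rewrite -normrM; congr `|_|; field.
  move=> /le_trans; apply.
  rewrite /d.
  have -> : `|b / a| `^ p = `|b| `^ p / `|a| `^ p.
    rewrite normrM normfV powRM ?invr_ge0//; congr (_ * _).
    by rewrite -(powR_inv1 (ltW ap)) -powRrM mulN1r powRN.
  have -> : `|(1 + b / a) / 2| `^ p = `|(a + b) / 2| `^ p / `|a| `^ p.
    have -> : (1 + b / a) / 2 = (a + b) / 2 / a by field.
    rewrite normrM normfV powRM ?invr_ge0//; congr (_ * _).
    by rewrite -(powR_inv1 (ltW ap)) -powRrM mulN1r powRN.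
  have -> : (e + C * ((1 + `|b| `^ p / `|a| `^ p) / 2 -
       `|(a + b) / 2| `^ p / `|a| `^ p)) * `|a| `^ p =
     e * `|a| `^ p + C * ((`|a| `^ p + `|b| `^ p) / 2 - `|(a + b) / 2| `^ p).
    by field; rewrite gt_eqF.
  rewrite lerD2r ler_wpM2l ?(ltW e0)// lerDl; exact: powR_ge0.
have near1 t : `|t| <= 1 -> 1 - h <= t -> `|1 - t| `^ p <= e.
  rewrite ler_norml => /andP[_ t1] ht; rewrite -hp.
  rewrite ge0_ler_powR ?nnegrE ?(ltW p_gt0) ?(ltW h0)//.
  by rewrite ger0_norm; lra.
(* For [2 <= h] all of [[-1, 1]] counts as near 1; otherwise [[-1, 1 - h]] is nonempty, as the
   extreme value theorem demands. *)
have [h2|h2] := leP 2 h.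
  exists 0 => // t t1; rewrite mul0r addr0 near1//.
  by move: t1; rewrite ler_norml => /andP[? _]; lra.
have [||t0 ht0 t0min] := @EVT_min R d (-1) (1 - h); first lra.
  exact: continuous_subspaceT.
move: ht0; rewrite in_itv/= => /andP[t0l t0r].
have m0 : 0 < d t0 by apply: midpoint_gap; rewrite ?ler_norml; lra.
exists (2 `^ p / d t0); first by rewrite divr_ge0 ?powR_ge0 ?ltW.
move=> t t1; have [ht|ht] := leP (1 - h) t.
  rewrite (le_trans (near1 _ t1 ht))// lerDl mulr_ge0 ?d_ge0//.
  by rewrite divr_ge0 ?powR_ge0 ?ltW.
apply: (@le_trans _ _ (2 `^ p)).
  rewrite ge0_ler_powR ?nnegrE ?(ltW p_gt0)//.
  by rewrite (le_trans (ler_normB _ _))// normr1; lra.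
apply: (@le_trans _ _ (2 `^ p / d t0 * d t)); last by rewrite lerDr ltW.
rewrite -mulrA ler_peMr ?powR_ge0// mulrC ler_pdivlMr// mul1r t0min//.
by rewrite in_itv/=; move: t1; rewrite ler_norml => /andP[-> _]/=; exact: ltW.
Qed.

End PowerInequalities.

(** * Signed powers and Picone's inequality without order *)

Section SignedPower.
Context {R : realType} (p : R).
Hypothesis p_gt1 : 1 < p.
Implicit Types a b t w F G : R.

Let p_gt0 : 0 < p. Proof. exact: lt_trans p_gt1. Qed.
Let pB1_gt0 : 0 < p - 1. Proof. by rewrite subr_gt0. Qed.

Definition spow t : R := `|t| `^ (p - 2) * t.

Lemma spow_ge0E t : 0 <= t -> spow t = t `^ (p - 1).
Proof.
move=> t0; rewrite /spow ger0_norm//; have [->|tn0] := eqVneq t 0.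
  by rewrite mulr0 powR0 ?gt_eqF.
have -> : p - 1 = p - 2 + 1 by ring.
by rewrite [RHS]powRD ?tn0 ?implybT// powRr1.
Qed.

Lemma spowN t : spow (- t) = - spow t.
Proof. by rewrite /spow normrN mulrN. Qed.

Lemma norm_spow t : `|spow t| = `|t| `^ (p - 1).
Proof.
rewrite -spow_ge0E// /spow normr_id normrM; congr (_ * _).
by rewrite ger0_norm// powR_ge0.
Qed.

Lemma spow_mul t : spow t * t = `|t| `^ p.
Proof.
case: (leP 0 t) => t0.
  by rewrite spow_ge0E// mulrC mulr_powRB1 ?ger0_norm.
rewrite -{1}(opprK t) spowN mulNr -mulrN spow_ge0E ?oppr_ge0 ?ltW//.
by rewrite mulrC mulr_powRB1 ?oppr_ge0 ?ltW// ltr0_norm.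
Qed.

Lemma le_spow a t : a <= t -> spow a <= spow t.
Proof.
have mono (x y : R) : 0 <= x -> x <= y -> x `^ (p - 1) <= y `^ (p - 1).
  by move=> x0 xy; rewrite ge0_ler_powR ?nnegrE ?(ltW pB1_gt0)// (le_trans x0).
move=> at_; case: (leP 0 a) => a0.
  by rewrite !spow_ge0E ?mono// (le_trans a0).
rewrite -(opprK a) spowN spow_ge0E ?oppr_ge0 ?(ltW a0)//.
case: (leP 0 t) => t0.
  by rewrite spow_ge0E// (@le_trans _ _ 0) ?oppr_le0 ?powR_ge0.
rewrite -(opprK t) spowN [spow (- t)]spow_ge0E ?oppr_ge0 ?(ltW t0)//.
by rewrite lerN2 mono ?oppr_ge0 ?(ltW t0)// lerN2.
Qed.

Lemma picone F G a b : 0 <= F -> 0 <= G -> 0 < a -> 0 < b ->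
  spow (a - b) * (F `^ p / a `^ (p - 1) - G `^ p / b `^ (p - 1)) <=
  `|F - G| `^ p.
Proof.
move=> F0 G0 a0 b0; have [ba|/ltW ab] := leP b a.
  by rewrite spow_ge0E ?subr_ge0// picone_ordered.
rewrite -(opprB b a) spowN mulNr -mulrN opprB distrC spow_ge0E ?subr_ge0//.
exact: picone_ordered.
Qed.

(** Picone's inequality with [G = b = w], where the second quotient collapses to [w]; in this form
    [w = 0] is allowed. *)
Lemma picone_diag F a w : 0 <= F -> 0 < a -> 0 <= w ->
  spow (a - w) * (F `^ p / a `^ (p - 1) - w) <= `|F - w| `^ p.
Proof.
move=> F0 a0; rewrite le_eqVlt => /predU1P[<-|w0].
  rewrite !subr0 spow_ge0E ?(ltW a0)// mulrC divfK ?ger0_norm//.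
  by rewrite gt_eqF// powR_gt0.
have := picone F0 (ltW w0) a0 w0.
by rewrite -{1}(@mulr_powRB1 _ w p) ?(ltW w0)// mulfK// gt_eqF// powR_gt0.
Qed.

End SignedPower.

(** * Unconditional sums of real families *)

Lemma cvg_sum_seq (R : realType) (I : Type) (s : seq I) (F : nat -> I -> R)
    (L : I -> R) : (forall i, F n i @[n --> \oo] --> L i) ->
  \sum_(i <- s) F n i @[n --> \oo] --> \sum_(i <- s) L i.
Proof.
move=> FL; elim: s => [|i s IH].
  by under eq_fun do rewrite big_nil; rewrite big_nil; exact: cvg_cst.
under eq_fun do rewrite big_cons; rewrite big_cons.
exact: cvgD (FL i) IH.
Qed.

Section RealSums.
Context {R : realType} {T : countType}.
Implicit Types (a b : T -> R) (s : seq T) (M : R).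

Definition summ a : Prop := (\esum_(x in [set: T]) `|a x|%:E < +oo)%E.
(** [fine] sends infinite values to 0, so this is the sum only in the presence of [summ]. *)
Definition rsum a : R := fine (usum a).

Lemma esum_leP a M : (forall x, 0 <= a x) ->
  (\esum_(x in [set: T]) (a x)%:E <= M%:E)%E <->
  (forall s, uniq s -> \sum_(x <- s) a x <= M).
Proof.
move=> a0; split=> [aM s us|aM].
  rewrite -lee_fin; apply: le_trans aM; apply: esum_ge.
  exists [set` s]; first by split => //; exact: finite_seq.
  by rewrite -fsbig_seq// sumEFin.
apply: ge_ereal_sup => _ [A [finA _]] <-.
by rewrite fsbig_finite// sumEFin lee_fin aM// finmap.fset_uniq.
Qed.

Lemma summ_ge0 a : (forall x, 0 <= a x) ->
  summ a = (\esum_(x in [set: T]) (a x)%:E < +oo)%E.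
Proof. by move=> a0; congr (_ < _)%E; apply: eq_esum => x _; rewrite ger0_norm. Qed.

Lemma le_summ a b : (forall x, `|a x| <= b x) -> summ b -> summ a.
Proof.
move=> ab; apply: le_lt_trans; apply: le_esum => x _.
by rewrite lee_fin (le_trans (ab x))// ler_norm.
Qed.

Lemma eq_summ a b : a =1 b -> summ a -> summ b.
Proof. by move=> /funext ->. Qed.

Lemma summD a b : summ a -> summ b -> summ (fun x => a x + b x).
Proof.
move=> sa sb; apply: le_lt_trans (lte_add_pinfty sa sb).
rewrite -esumD//; apply: le_esum => x _.
by rewrite -EFinD lee_fin ler_normD.
Qed.

Lemma summN a : summ a -> summ (fun x => - a x).
Proof. by apply: le_lt_trans; apply: le_esum => x _; rewrite normrN. Qed.

Lemma summB a b : summ a -> summ b -> summ (fun x => a x - b x).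
Proof. by move=> sa /summN sb; exact: summD sb. Qed.

Lemma summ_norm a : summ a -> summ (fun x => `|a x|).
Proof. by apply: le_lt_trans; apply: le_esum => x _; rewrite normr_id. Qed.

Let funrposneg a x : a x = a^\+ x - a^\- x.
Proof. by rewrite -[in LHS](funrposBneg a). Qed.

Lemma summ_funrpos a : summ a -> summ a^\+.
Proof.
move=> /summ_norm; apply: le_summ => x; rewrite ger0_norm//.
by rewrite /funrpos ge_max ler_norm normr_ge0.
Qed.

Lemma summ_funrneg a : summ a -> summ a^\-.
Proof.
move=> /summ_norm; apply: le_summ => x; rewrite ger0_norm//.
by rewrite /funrneg ge_max -normrN ler_norm normr_ge0.
Qed.

Lemma esumZ_fin k a : 0 <= k -> (forall x, 0 <= a x) ->
  (\esum_(x in [set: T]) (k * a x)%:E = k%:E * \esum_(x in [set: T]) (a x)%:E)%E.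
Proof.
(* One inequality is enough: the converse is the same one for [k^-1] and the family [k * a]. *)
have le1 (t : R) (c : T -> R) : 0 < t -> (forall x, 0 <= c x) ->
    (\esum_(x in [set: T]) (t * c x)%:E <=
     t%:E * \esum_(x in [set: T]) (c x)%:E)%E.
  move=> t0 c0.
  have : (0 <= \esum_(x in [set: T]) (c x)%:E)%E by apply: esum_ge0 => x _; rewrite lee_fin.
  case E : (\esum_(x in _) (c x)%:E)%E => [r| |]//; last first.
    by move=> _; rewrite gt0_muley ?lte_fin// leey.
  move=> _; rewrite -EFinM; apply/esum_leP; first by move=> x; rewrite mulr_ge0// ltW.
  move=> s us; rewrite -mulr_sumr ler_wpM2l ?(ltW t0)//.
  by move: s us; apply/esum_leP => //; rewrite E.
rewrite le_eqVlt => /predU1P[<-|k0] a0.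
  by rewrite mul0e esum1// => x _; rewrite mul0r.
apply/eqP; rewrite eq_le le1//= -lee_pdivlMl//.
have := le1 k^-1 (fun x => k * a x).
rewrite invr_gt0 => /(_ k0).
have -> : (fun x => (k^-1 * (k * a x))%:E) = fun x => (a x)%:E.
  by apply/funext => x; rewrite mulKf ?gt_eqF.
by apply => x; rewrite mulr_ge0// ltW.
Qed.

Lemma summZ k a : summ a -> summ (fun x => k * a x).
Proof.
move=> sa; rewrite /summ.
under eq_esum do rewrite normrM.
rewrite esumZ_fin//.
have : (0 <= \esum_(x in [set: T]) (`|a x|)%:E)%E by apply: esum_ge0.
by move: sa; rewrite /summ; case: (\esum_(x in _) _)%E => // r _ _; rewrite -EFinM ltry.
Qed.

Lemma esum_fin_num a : (forall x, 0 <= a x) -> summ a ->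
  (\esum_(x in [set: T]) (a x)%:E)%E \is a fin_num.
Proof.
move=> a0; rewrite summ_ge0// => sa; rewrite ge0_fin_numE//.
by apply: esum_ge0 => x _; rewrite lee_fin.
Qed.

Lemma rsum_diff a b : (forall x, 0 <= a x) -> (forall x, 0 <= b x) ->
  summ a -> summ b ->
  usum (fun x => a x - b x) =
   (\esum_(x in [set: T]) (a x)%:E - \esum_(x in [set: T]) (b x)%:E)%E.
Proof.
move=> a0 b0 sa sb.
rewrite -(@esumB _ _ setT (EFin \o a) (EFin \o b))//; last 2 first.
- by move=> x _; rewrite lee_fin.
- by move=> x _; rewrite lee_fin.
rewrite /usum; congr (_ - _)%E; apply: eq_esum => x _.
  by rewrite funeposE /= EFin_max.
by rewrite funenegE /= EFin_max.
Qed.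

Lemma usumE a : summ a -> usum a = (rsum a)%:E.
Proof.
move=> sa; rewrite /rsum fineK//.
by rewrite /usum fin_numB !esum_fin_num//; [exact: summ_funrneg|exact: summ_funrpos].
Qed.

Lemma rsum_ge0E a : (forall x, 0 <= a x) -> summ a ->
  (\esum_(x in [set: T]) (a x)%:E)%E = (rsum a)%:E.
Proof.
move=> a0 sa; rewrite -usumE//.
have := @rsum_diff a (fun=> 0) a0 (fun=> lexx _) sa.
have s0 : summ (fun=> 0 : R).
  by rewrite /summ esum1// => x _; rewrite normr0.
move=> /(_ s0); rewrite [X in (_ - X)%E]esum1// sube0 => <-.
by congr usum; apply/funext => x; rewrite subr0.
Qed.

Lemma eq_rsum a b : a =1 b -> rsum a = rsum b.
Proof. by move=> /funext ->. Qed.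

Let rsum_diffE a b : (forall x, 0 <= a x) -> (forall x, 0 <= b x) ->
  summ a -> summ b -> rsum (fun x => a x - b x) = rsum a - rsum b.
Proof.
move=> a0 b0 sa sb; apply: EFin_inj; rewrite EFinB.
rewrite -(rsum_ge0E a0)// -(rsum_ge0E b0)// -rsum_diff//.
by rewrite usumE//; exact: summB.
Qed.

Let rsumD_ge0 a b : (forall x, 0 <= a x) -> (forall x, 0 <= b x) ->
  summ a -> summ b -> rsum (fun x => a x + b x) = rsum a + rsum b.
Proof.
move=> a0 b0 sa sb; apply: EFin_inj; rewrite EFinD -!rsum_ge0E//.
- by rewrite -esumD// => x _; rewrite lee_fin.
- by move=> x; rewrite addr_ge0.
- exact: summD.
Qed.

Lemma rsumD a b : summ a -> summ b ->
  rsum (fun x => a x + b x) = rsum a + rsum b.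
Proof.
move=> sa sb.
have -> : (fun x => a x + b x) =
    fun x => (a^\+ x + b^\+ x) - (a^\- x + b^\- x).
  by apply/funext => x; rewrite {1}(funrposneg a) {1}(funrposneg b); ring.
rewrite (eq_rsum (funrposneg a)) (eq_rsum (funrposneg b)).
have [pa na pb nb] : [/\ summ (a^\+), summ (a^\-), summ (b^\+) & summ (b^\-)].
  by split; do ?[exact: summ_funrpos|exact: summ_funrneg].
rewrite !rsum_diffE//; [|by move=> x; rewrite addr_ge0|by move=> x; rewrite addr_ge0|
  exact: summD|exact: summD].
by rewrite !rsumD_ge0//; ring.
Qed.

Lemma rsumN a : summ a -> rsum (fun x => - a x) = - rsum a.
Proof.
move=> sa; apply/eqP; rewrite -addr_eq0 addrC -rsumD//; last exact: summN.
have -> : (fun x => a x + - a x) = fun=> (0 : R) - 0.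
  by apply/funext => x; rewrite subrr subr0.
rewrite rsum_diffE ?subrr//; by rewrite /summ esum1// => x _; rewrite normr0.
Qed.

Lemma rsumB a b : summ a -> summ b ->
  rsum (fun x => a x - b x) = rsum a - rsum b.
Proof. by move=> sa sb; rewrite rsumD ?rsumN//; exact: summN. Qed.

Lemma rsum_ge0 a : (forall x, 0 <= a x) -> 0 <= rsum a.
Proof.
move=> a0; rewrite /rsum /usum [X in (_ - X)%E]esum1 ?sube0.
  by rewrite fine_ge0// esum_ge0// => x _; rewrite lee_fin funrpos_ge0.
by move=> x _; rewrite /funrneg max_r// oppr_le0.
Qed.

Lemma le_rsum a b : summ a -> summ b -> (forall x, a x <= b x) ->
  rsum a <= rsum b.
Proof.
move=> sa sb ab; rewrite -subr_ge0 -rsumB//.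
by apply: rsum_ge0 => x; rewrite subr_ge0.
Qed.

Lemma rsumZ k a : summ a -> rsum (fun x => k * a x) = k * rsum a.
Proof.
move=> sa.
have pos t (c : T -> R) : 0 <= t -> (forall x, 0 <= c x) -> summ c ->
    rsum (fun x => t * c x) = t * rsum c.
  move=> t0 c0 sc; apply: EFin_inj; rewrite EFinM -!rsum_ge0E ?esumZ_fin//.
    by move=> x; rewrite mulr_ge0.
  exact: summZ.
wlog k0 : k / 0 <= k.
  move=> h; have [|k0] := leP 0 k; first exact: h.
  have := h (- k); rewrite oppr_ge0 => /(_ (ltW k0)).
  have -> : (fun x => - k * a x) = fun x => - (k * a x).
    by apply/funext => x; rewrite mulNr.
  by rewrite rsumN ?mulNr; [move=> /oppr_inj|exact: summZ].
have -> : (fun x => k * a x) = fun x => k * a^\+ x - k * a^\- x.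
  by apply/funext => x; rewrite {1}(funrposneg a) mulrBr.
have sp := summ_funrpos sa; have sn := summ_funrneg sa.
rewrite rsumB ?pos//; [|exact: summZ|exact: summZ].
by rewrite (eq_rsum (funrposneg a)) rsumB// mulrBr.
Qed.

Lemma ler_norm_rsum a : summ a -> `|rsum a| <= rsum (fun x => `|a x|).
Proof.
move=> sa; have sn := summ_norm sa; rewrite ler_norml -rsumN//.
apply/andP; split; apply: le_rsum => //; first exact: summN.
  by move=> x; rewrite lerNl -normrN ler_norm.
by move=> x; exact: ler_norm.
Qed.

Lemma rsum_le_seq a M : (forall x, 0 <= a x) ->
  (forall s, uniq s -> \sum_(x <- s) a x <= M) -> summ a /\ rsum a <= M.
Proof.
move=> a0 /esum_leP-/(_ a0) aM.
have sa : summ a by rewrite summ_ge0// (le_lt_trans aM)// ltry.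
by split => //; rewrite -lee_fin -rsum_ge0E.
Qed.

Lemma ler_seq_rsum a s : (forall x, 0 <= a x) -> summ a -> uniq s ->
  \sum_(x <- s) a x <= rsum a.
Proof.
move=> a0 sa us; have /esum_leP : (\esum_(x in [set: T]) (a x)%:E <= (rsum a)%:E)%E.
  by rewrite rsum_ge0E.
exact.
Qed.

Lemma rsum_seq a s : uniq s -> (forall x, x \notin s -> a x = 0) ->
  summ a /\ rsum a = \sum_(x <- s) a x.
Proof.
move=> us a_out.
have key b : (forall x, 0 <= b x) -> (forall x, x \notin s -> b x = 0) ->
    summ b /\ rsum b = \sum_(x <- s) b x.
  move=> b0 b_out; have [] := @rsum_le_seq b (\sum_(x <- s) b x) b0.
    move=> t ut; rewrite (bigID (mem s))/= [X in _ + X]big1_seq ?addr0; last first.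
      by move=> x /andP[xs _]; exact: b_out.
    rewrite [leRHS](bigID (mem t))/= ler_wpDr ?sumr_ge0// le_eqVlt.
    apply/orP; left; rewrite -big_filter -[X in _ == X]big_filter.
    apply/eqP/perm_big/uniq_perm; rewrite ?filter_uniq//.
    by move=> x; rewrite !mem_filter andbC.
  move=> sb le; split => //; apply/eqP; rewrite eq_le le/=.
  exact: ler_seq_rsum.
have out0 x : x \notin s -> a^\+ x = 0 /\ a^\- x = 0.
  by move=> xs; rewrite /funrpos /funrneg a_out// oppr0 maxxx.
have [sp rp] := key _ (funrpos_ge0 a) (fun x xs => (out0 x xs).1).
have [sn rn] := key _ (funrneg_ge0 a) (fun x xs => (out0 x xs).2).
split.
  by apply: (@eq_summ (fun x => a^\+ x - a^\- x)) => [x|]; [rewrite -funrposneg|exact: summB].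
rewrite (eq_rsum (funrposneg a)) rsumB// rp rn -sumrB.
by apply: eq_bigr => x _; rewrite -funrposneg.
Qed.

Lemma rsum_split a s : summ a -> uniq s ->
  summ (fun x => if x \in s then 0 else a x) /\
  rsum a = \sum_(x <- s) a x + rsum (fun x => if x \in s then 0 else a x).
Proof.
move=> sa us.
have s_out : summ (fun x => if x \in s then 0 else a x).
  by apply: le_summ (summ_norm sa) => x; case: ifP => _ //; rewrite normr0.
have [s_in s_inE] := @rsum_seq (fun x => if x \in s then a x else 0) s us
  (fun x xs => ifN _ _ xs).
split => //; have -> : \sum_(x <- s) a x = rsum (fun x => if x \in s then a x else 0).
  by rewrite s_inE !big_seq; apply: eq_bigr => x ->.
rewrite -rsumD//; apply: eq_rsum => x.
by case: ifP; rewrite ?addr0 ?add0r.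
Qed.

(** If all tails were at least [e], every finite sum, hence [rsum a] itself, would be at most
    [rsum a - e]. *)
Lemma rsum_tail a e : (forall x, 0 <= a x) -> summ a -> 0 < e ->
  exists2 s, uniq s & rsum (fun x => if x \in s then 0 else a x) < e.
Proof.
move=> a0 sa e0; apply: contrapT => no.
have [|_] := @rsum_le_seq a (rsum a - e) a0; last by lra.
move=> s us; have [_ ->] := rsum_split sa us.
have : e <= rsum (fun x => if x \in s then 0 else a x).
  by rewrite leNgt; apply/negP => h; apply: no; exists s.
lra.
Qed.

(** Dominated convergence: one finite list makes the tails of all [a n] and of [l] small at once,
    and on the list only finitely many limits remain. *)
Lemma tannery (a : nat -> T -> R) (l D : T -> R) : summ D ->
  (forall n x, `|a n x| <= D x) ->
  (forall x, a n x @[n --> \oo] --> l x) ->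
  summ l /\ rsum (a n) @[n --> \oo] --> rsum l.
Proof.
move=> sD aD al.
have lD x : `|l x| <= D x.
  by apply: (cvgr_to_le (cvg_norm (al x))); near=> n; exact: aD.
have D0 x : 0 <= D x by exact: le_trans (lD x).
have sl : summ l by exact: le_summ lD sD.
have sa n : summ (a n) by exact: le_summ (aD n) sD.
split => //; apply/cvgrPdist_lt => e e0.
have e3 : 0 < e / 3 by rewrite divr_gt0.
have [s us sE] := rsum_tail D0 sD e3.
have tail b : (forall x, `|b x| <= D x) ->
    `|rsum (fun x => if x \in s then 0 else b x)| < e / 3.
  move=> bD; have sb := le_summ bD sD.
  have [sb' _] := rsum_split sb us; have [sD' _] := rsum_split sD us.
  apply: le_lt_trans (ler_norm_rsum sb') (le_lt_trans _ sE).
  apply: le_rsum => //; first exact: summ_norm.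
  by move=> x; case: ifP => // _; rewrite normr0.
have : \sum_(x <- s) a n x @[n --> \oo] --> \sum_(x <- s) l x.
  by apply: cvg_sum_seq => x; exact: al.
move=> /cvgrPdist_lt /(_ _ e3); apply: filterS => n hn.
have [_ ->] := rsum_split sl us; have [_ ->] := rsum_split (sa n) us.
have := tail _ lD; have := tail _ (aD n); move: hn.
set A := \sum_(x <- s) l x; set B := \sum_(x <- s) a n x.
set C := rsum _; set E := rsum _ => h1 h2 h3.
have -> : A + E - (B + C) = (A - B) + E + (- C) by ring.
apply: le_lt_trans (ler_normD _ _) _.
apply: le_lt_trans (lerD (ler_normD _ _) (lexx _)) _.
by rewrite normrN; lra.
Unshelve. all: by end_near. Qed.

End RealSums.

(** The two families, in practice edges and vertices, are bounded only jointly; so finite parts of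
    both pass to the limit together before either sum is completed. *)
Lemma fatou_rsum (R : realType) (T1 T2 : countType) (F : nat -> T1 -> R)
    (G : nat -> T2 -> R) (F' : T1 -> R) (G' : T2 -> R) (M : R) :
  (forall n x, 0 <= F n x) -> (forall n x, 0 <= G n x) ->
  (forall n, summ (F n)) -> (forall n, summ (G n)) ->
  (forall x, F n x @[n --> \oo] --> F' x) ->
  (forall x, G n x @[n --> \oo] --> G' x) ->
  (\forall n \near \oo, rsum (F n) + rsum (G n) <= M) ->
  [/\ summ F', summ G' & rsum F' + rsum G' <= M].
Proof.
move=> F0 G0 sF sG FF' GG' FGM.
have F'0 x : 0 <= F' x.
  by apply: (cvgr_to_ge (FF' x)); near=> n.
have G'0 x : 0 <= G' x.
  by apply: (cvgr_to_ge (GG' x)); near=> n.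
have key s t : uniq s -> uniq t ->
    \sum_(x <- s) F' x + \sum_(x <- t) G' x <= M.
  move=> us ut.
  have cv : \sum_(x <- s) F n x + \sum_(x <- t) G n x @[n --> \oo] -->
      \sum_(x <- s) F' x + \sum_(x <- t) G' x.
    by apply: cvgD; apply: cvg_sum_seq => x.
  apply: (cvgr_to_le cv); apply: filterS FGM => n; apply: le_trans.
  by rewrite lerD// ler_seq_rsum.
have [sF' F'le] : summ F' /\ rsum F' <= M.
  by apply: rsum_le_seq => // s us; have := key s [::] us isT; rewrite big_nil addr0.
have [sG' G'le] : summ G' /\ rsum G' <= M.
  by apply: rsum_le_seq => // s us; have := key [::] s isT us; rewrite big_nil add0r.
split => //; rewrite -lerBrDr.
apply: (rsum_le_seq F'0 _).2 => s us; rewrite lerBrDr -lerBrDl.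
apply: (rsum_le_seq G'0 _).2 => t ut; rewrite lerBrDl; exact: key.
Unshelve. all: by end_near. Qed.

(** * Sums over ordered pairs of vertices *)

Section ProductSums.
Context {R : realType}.

Lemma rsum_reindex (T T' : countType) (e : T -> T') (a : T' -> R) :
  bijective e -> summ a ->
  summ (fun x => a (e x)) /\ rsum (fun x => a (e x)) = rsum a.
Proof.
move=> be.
have se : set_bij [set: T] [set: T'] e by rewrite setTT_bijective.
have re (c : T' -> \bar R) := @reindex_esum R T T' setT setT e c se.
rewrite /summ (re (fun x => `|a x|%:E)) => sa; split => //.
by rewrite /rsum /usum !re.
Qed.

Context {X : countType}.
Implicit Types (k : X -> X -> R) (a : X * X -> R) (s : seq X).

Lemma rsum_swap a : summ a -> summ (fun e => a (e.2, e.1)) /\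
  rsum (fun e => a (e.2, e.1)) = rsum a.
Proof.
by move=> sa; apply: (@rsum_reindex _ _ (fun e : X * X => (e.2, e.1))) => //;
  exists (fun e => (e.2, e.1)) => -[].
Qed.

Lemma rsum_row (x : X) (k : X -> R) : summ k ->
  summ (fun e : X * X => if e.1 == x then k e.2 else 0) /\
  rsum (fun e : X * X => if e.1 == x then k e.2 else 0) = rsum k.
Proof.
have re (c : X -> \bar R) :
    (\esum_(e in [set: X * X]) (if e.1 == x then c e.2 else 0) =
     \esum_(y in [set: X]) c y)%E.
  transitivity (\esum_(e in (pair x) @` [set: X]) c e.2)%E; last first.
    by rewrite esum_image// => y z _ _ [].
  rewrite [RHS]esum_mkcond; apply: eq_esum => -[u v] _ /=.
  have [->|ux] := eqVneq u x; first by rewrite mem_set//; exists v.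
  by rewrite memNset// => -[w _ [/esym/eqP]]; rewrite (negPf ux).
rewrite /summ -(re (fun y => `|k y|%:E)) => sk; split.
  by apply: le_lt_trans sk; apply: le_esum => e _; case: ifP; rewrite ?normr0.
rewrite /rsum /usum -[in RHS]re -[X in _ = fine (_ - X)%E]re.
congr (fine (_ - _)%E); apply: eq_esum => e _.
  by rewrite /funrpos; case: ifP; rewrite ?maxxx.
by rewrite /funrneg; case: ifP; rewrite ?oppr0 ?maxxx.
Qed.

Lemma rsum_rows s k : uniq s -> (forall x, x \in s -> summ (k x)) ->
  summ (fun e : X * X => if e.1 \in s then k e.1 e.2 else 0) /\
  rsum (fun e : X * X => if e.1 \in s then k e.1 e.2 else 0) =
    \sum_(x <- s) rsum (k x).
Proof.
elim: s => [_ _|x s IH /= /andP[xs us] sk].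
  by rewrite big_nil; have [] := @rsum_seq R (X * X)%type (fun=> 0) [::] isT
    (fun _ _ => erefl); rewrite big_nil.
have [s1 e1] := rsum_row x (sk x (mem_head _ _)).
have [|s2 e2] := IH us.
  by move=> y ys; apply: sk; rewrite in_cons ys orbT.
have E : (fun e : X * X => if e.1 \in x :: s then k e.1 e.2 else 0) =
    fun e => (if e.1 == x then k x e.2 else 0) +
             (if e.1 \in s then k e.1 e.2 else 0).
  apply/funext => -[u v] /=; rewrite in_cons; have [->|ux] := eqVneq u x.
    by rewrite (negPf xs) addr0.
  by rewrite add0r.
by rewrite E; split; [exact: summD|rewrite rsumD// e1 e2 big_cons].
Qed.

(** An edge with an end in [s] is charged to the row of that end. Each row is charged through both
    coordinates; the factor 2 is undone by the factor 1/2 of the energy. *)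
Lemma rsum_edges_le s k a : uniq s -> (forall x, x \in s -> summ (k x)) ->
  summ a ->
  (forall x y, a (x, y) <= (if x \in s then k x y else 0) +
                           (if y \in s then k y x else 0)) ->
  rsum a <= 2 * \sum_(x <- s) rsum (k x).
Proof.
move=> us sk sa ale; have [s1 e1] := rsum_rows us sk.
have [s2 e2] := rsum_swap s1.
rewrite -e1 mulr_natl mulr2n -{2}e2 -rsumD//.
by apply: le_rsum => //; [exact: summD|case].
Qed.

End ProductSums.

(** * Extraction of pointwise limits *)

Lemma filter_pickle (X : countType) (T : Type) (F : set_system T) (P : X -> set T)
    (n : nat) : Filter F -> (forall x, F (P x)) ->
  F [set t | forall x, (pickle x < n)%N -> P x t].
Proof.
move=> FF FP; elim: n => [|n IH]; first exact: filterE.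
have [[x xn]|no] := pselect (exists x : X, pickle x = n); last first.
  apply: filterS IH => t tP x; rewrite ltnS leq_eqVlt => /predU1P[xn|]; last exact: tP.
  by case: no; exists x.
apply: filterS (filterI IH (FP x)) => t [tP tx] y.
rewrite ltnS leq_eqVlt => /predU1P[yn|]; last exact: tP.
by have -> : y = x by apply: (pcan_inj (@pickleK X)); rewrite yn.
Qed.

(** Tychonoff gives a cluster point in the product of the segments. As [X] is countable, closeness
    at the points with code below [n] is a single neighbourhood, from which [k n] is chosen;
    [n <= k n] suffices for properties that hold eventually. *)
Lemma bounded_subsequence (R : realType) (X : countType) (v : nat -> X -> R)
    (w : X -> R) : (forall n x, `|v n x| <= w x) ->
  exists (k : nat -> nat) (f : X -> R), (forall n, n <= k n)%N /\
    forall x, v (k n) x @[n --> \oo] --> f x.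
Proof.
move=> vw; pose A x : set R := `[- w x, w x]%classic.
have cA : @compact (prod_topology (fun _ : X => R)) [set f | forall x, A x (f x)].
  by apply: tychonoff => x; exact: segment_compact.
pose F : set_system (prod_topology (fun _ : X => R)) := v @ \oo.
have FF : ProperFilter F by exact: fmap_proper_filter.
have FA : F [set f | forall x, A x (f x)].
  by exists 0%N => // n _ x; rewrite /A/= in_itv/= -ler_norml.
have [f [_ clf]] := cA F FF FA.
have FN : Filter (nbhs (f : prod_topology (fun _ : X => R))) by exact: nbhs_filter.
have near_all n : nbhs (f : prod_topology (fun _ : X => R))
    [set g | forall x, (pickle x < n)%N -> `|g x - f x| < n.+1%:R^-1].
  apply: filter_pickle => x.
  have := @proj_continuous X (fun=> R) x f.
  move=> /cvgrPdist_lt /(_ n.+1%:R^-1).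
  rewrite invr_gt0 ltr0n => /(_ isT); apply: filterS => g /=.
  by rewrite distrC.
have /choice[k kP] : forall n, exists k, (n <= k)%N /\
    forall x, (pickle x < n)%N -> `|v k x - f x| < n.+1%:R^-1.
  move=> n; have FU : F [set g | exists2 k, (n <= k)%N & g = v k].
    by exists n => // k /= nk; exists k.
  by have [_ [[k nk ->] gk]] := clf _ _ FU (near_all n); exists k.
exists k, f; split => [n|x]; first by have [] := kP n.
apply/cvgrPdist_lt => e e0.
near=> n.
have /(_ x) := (kP n).2.
have xn : (pickle x < n)%N by near: n; exact: nbhs_infty_gt.
move=> /(_ xn); rewrite distrC => /lt_trans; apply.
rewrite invf_plt ?posrE//.
near: n; have := near_infty_natSinv_lt (PosNum e0).
by apply: filterS => n /=; rewrite invf_plt ?posrE.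
Unshelve. all: by end_near. Qed.

(** * The p-energy *)

Section Energy.
Context {R : realType} {X : countType} (p : R) (b : X -> X -> R).
Hypothesis p_gt1 : 1 < p.
Hypothesis b_graph : connected_graph b.
Implicit Types (f g phi V : X -> R) (s : seq X).

Let p_gt0 : 0 < p. Proof. exact: lt_trans p_gt1. Qed.
Let p_ge0 : 0 <= p. Proof. exact: ltW. Qed.
Let p_neq0 : p != 0. Proof. by rewrite gt_eqF. Qed.
Let pB1_gt0 : 0 < p - 1. Proof. by rewrite subr_gt0. Qed.
Let pB1_ge0 : 0 <= p - 1. Proof. exact: ltW. Qed.
Let powp0 : (0 : R) `^ p = 0. Proof. by rewrite powR0. Qed.
Let powq0 : (0 : R) `^ (p - 1) = 0. Proof. by rewrite powR0// gt_eqF. Qed.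

Let b_ge0 x y : 0 <= b x y. Proof. by case: b_graph. Qed.
Let bC x y : b x y = b y x. Proof. by case: b_graph. Qed.
Let b_diag x : b x x = 0. Proof. by case: b_graph. Qed.
Let b_summ x : summ (b x).
Proof. by case: b_graph => _ _ _ h _; rewrite summ_ge0//; exact: h. Qed.

Definition edge_density f (e : X * X) : R := b e.1 e.2 * `|f e.1 - f e.2| `^ p.
Definition vertex_density V f (x : X) : R := V x * `|f x| `^ p.
(** The potential is a parameter: [c] gives [Q], [c^\+] gives [Q_+], and [c - l W] gives [h]. *)
Definition renergy V f : R :=
  2^-1 * rsum (edge_density f) + rsum (vertex_density V f).

Definition finsupp f : Prop :=
  exists2 s, uniq s & forall x, x \notin s -> f x = 0.

Let edge_ge0 f e : 0 <= edge_density f e.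
Proof. by rewrite mulr_ge0// powR_ge0. Qed.

Lemma summ_edges s (k : X -> X -> R) (a : X * X -> R) : uniq s ->
  (forall x, x \in s -> summ (k x)) ->
  (forall x y, `|a (x, y)| <= (if x \in s then k x y else 0) +
                              (if y \in s then k y x else 0)) ->
  summ a.
Proof.
move=> us sk ale; have [s1 _] := rsum_rows us sk.
have [s2 _] := rsum_swap s1.
by apply: le_summ (summD s1 s2); case.
Qed.

Lemma finsupp_le f g : (forall x, f x = 0 -> g x = 0) -> finsupp f -> finsupp g.
Proof. by move=> fg [s us s0]; exists s => // x /s0 /fg. Qed.

Lemma finsuppD f g : finsupp f -> finsupp g -> finsupp (fun x => f x + g x).
Proof.
move=> [s us s0] [t ut t0]; exists (undup (s ++ t)); first exact: undup_uniq.
by move=> x; rewrite mem_undup mem_cat negb_or => /andP[/s0 -> /t0 ->]; rewrite addr0.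
Qed.

Lemma summ_vertex_finsupp (F : X -> R) f :
  finsupp f -> (forall x, f x = 0 -> F x = 0) -> summ F.
Proof. by move=> [s us s0] fF; have [] := rsum_seq us (fun x xs => fF x (s0 x xs)). Qed.

Lemma summ_vertex V f : finsupp f -> summ (vertex_density V f).
Proof.
move=> ff; apply: (summ_vertex_finsupp ff) => x fx0.
by rewrite /vertex_density fx0 normr0 powp0 mulr0.
Qed.

Lemma summ_edge f : finsupp f -> summ (edge_density f).
Proof.
move=> [s us s0]; pose M := \sum_(x <- s) `|f x|.
have M0 : 0 <= M by apply: sumr_ge0.
have fM x : `|f x| <= M.
  have [xs|/s0 ->] := boolP (x \in s); last by rewrite normr0.
  by rewrite /M (bigD1_seq x)//= lerDl sumr_ge0.
apply: (@summ_edges s (fun x y => (2 * M) `^ p * b x y)) => //.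
  by move=> x _; exact: summZ.
move=> x y; rewrite ger0_norm ?edge_ge0// /edge_density/= mulrC.
have le2 : `|f x - f y| `^ p <= (2 * M) `^ p.
  rewrite ge0_ler_powR ?nnegrE ?mulr_ge0//.
  by rewrite (le_trans (ler_normB _ _))// mulr_natl mulr2n lerD.
have t0 z w : 0 <= (2 * M) `^ p * b z w by rewrite mulr_ge0// powR_ge0.
have [xs|xs] := boolP (x \in s).
  by apply: ler_wpDr; [case: ifP|rewrite ler_wpM2r].
have [ys|ys] := boolP (y \in s); first by rewrite add0r (bC y) ler_wpM2r.
by rewrite (s0 _ xs) (s0 _ ys) subrr normr0 powp0 mul0r addr0.
Qed.

Lemma renergyD V W f : summ (vertex_density V f) -> summ (vertex_density W f) ->
  renergy (fun x => V x + W x) f = renergy V f + rsum (vertex_density W f).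
Proof.
move=> sV sW; rewrite /renergy -addrA -rsumD//; congr (_ + _).
by apply: eq_rsum => x; rewrite /vertex_density mulrDl.
Qed.

Lemma renergyB V W f : summ (vertex_density V f) -> summ (vertex_density W f) ->
  renergy (fun x => V x - W x) f = renergy V f - rsum (vertex_density W f).
Proof.
move=> sV sW; rewrite /renergy -addrA -rsumB//; congr (_ + _).
by apply: eq_rsum => x; rewrite /vertex_density mulrBl.
Qed.

Lemma vertexZ V t f x :
  vertex_density V (fun x => t * f x) x = `|t| `^ p * vertex_density V f x.
Proof. by rewrite /vertex_density normrM powRM//; ring. Qed.

Lemma renergyZ V t f : finsupp f ->
  renergy V (fun x => t * f x) = `|t| `^ p * renergy V f.
Proof.
move=> ff; rewrite /renergy mulrDr -(rsumZ _ (summ_vertex _ ff)) mulrCA.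
rewrite -(rsumZ _ (summ_edge ff)); congr (_ * _ + _); apply: eq_rsum => x.
  by rewrite /edge_density -mulrBr normrM powRM//; ring.
by rewrite vertexZ.
Qed.

Lemma renergy_norm V f : finsupp f ->
  renergy V (fun x => `|f x|) <= renergy V f.
Proof.
move=> ff; have fn : finsupp (fun x => `|f x|).
  by apply: finsupp_le ff => x ->; rewrite normr0.
apply: lerD; last first.
  suff -> : vertex_density V (fun x => `|f x|) = vertex_density V f by [].
  by apply/funext => x; rewrite /vertex_density normr_id.
rewrite ler_wpM2l//; apply: le_rsum; [exact: summ_edge|exact: summ_edge|].
move=> e; rewrite /edge_density ler_wpM2l// ge0_ler_powR ?nnegrE//.
exact: ler_dist_dist.
Qed.

(** * Cutting off, doubling at a point, truncating *)

Definition cut s f x := if x \in s then 0 else f x.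

Lemma finsupp_cut s f : finsupp f -> finsupp (cut s f).
Proof. by apply: finsupp_le => x; rewrite /cut => ->; rewrite if_same. Qed.

Lemma vertex_cut V s f : finsupp f -> uniq s ->
  rsum (vertex_density V f) =
    \sum_(x <- s) V x * `|f x| `^ p + rsum (vertex_density V (cut s f)).
Proof.
move=> ff us; have [_ ->] := rsum_split (summ_vertex V ff) us.
congr (_ + _); apply: eq_rsum => x; rewrite /vertex_density /cut.
by case: ifP => //; rewrite normr0 powp0 mulr0.
Qed.

(** Edges inside [s] only lose energy, and an edge leaving [s] is bounded by [powR_sub_le]. The
    error is kept as a row sum because this is what [almost_minimizer_row] controls. *)
Lemma renergy_cut V s f : finsupp f -> uniq s -> (forall x, 0 <= f x) ->
  renergy V (cut s f) <= renergy V f + \sum_(x <- s)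
    (p * f x * rsum (fun y => b x y * f y `^ (p - 1)) + `|V x| * f x `^ p).
Proof.
move=> ff us f0; have fc := finsupp_cut s ff.
have sR x : summ (fun y => b x y * f y `^ (p - 1)).
  by apply: (summ_vertex_finsupp ff) => y ->; rewrite powq0 mulr0.
rewrite big_split/= {2}/renergy (vertex_cut V ff us).
rewrite /renergy.
have vert : 0 <= \sum_(x <- s) V x * `|f x| `^ p + \sum_(x <- s) `|V x| * f x `^ p.
  rewrite -big_split/=; apply: sumr_ge0 => x _.
  rewrite ger0_norm// -mulrDl mulr_ge0 ?powR_ge0//.
  by have := ler_norm (- V x); rewrite normrN; lra.
have arith (E E' A B C D : R) : 0 <= A + D -> E' - E <= C ->
  E' + B <= E + (A + B) + (C + D) by lra.
apply: arith vert _.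
rewrite -mulrBr mulrC ler_pdivrMr// mulrC.
rewrite -rsumB; [|exact: summ_edge|exact: summ_edge].
under eq_bigr do rewrite -(rsumZ _ (sR _)).
apply: (@rsum_edges_le _ _ s (fun x y => p * f x * (b x y * f y `^ (p - 1)))) => //.
- by move=> x _; exact: summZ.
- by apply: summB; exact: summ_edge.
move=> x y; rewrite /edge_density/= -mulrBr.
have k0 z w : 0 <= p * f z * (b z w * f w `^ (p - 1)).
  by rewrite !mulr_ge0// powR_ge0.
have np z : `| 0 - f z | = f z by rewrite sub0r normrN ger0_norm.
rewrite /cut; case: ifPn => xs; case: ifPn => ys.
- rewrite subrr normr0 powp0 sub0r mulrN.
  by rewrite (@le_trans _ _ 0) ?oppr_le0 ?mulr_ge0 ?powR_ge0// addr_ge0.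
- rewrite addr0 np mulrCA ler_wpM2l//.
  exact: powR_sub_le.
- rewrite add0r subr0 (ger0_norm (f0 x)) distrC (bC y) mulrCA ler_wpM2l//.
  exact: powR_sub_le.
- by rewrite subrr mulr0 addr0.
Qed.

Definition bump x t f : X -> R := fun y => if y == x then f y + t else f y.

Lemma finsupp_bump x t f : finsupp f -> finsupp (bump x t f).
Proof.
move=> [s us s0]; exists (undup (x :: s)); first exact: undup_uniq.
by move=> y; rewrite mem_undup in_cons negb_or /bump => /andP[/negPf -> /s0].
Qed.

(* Doubling the value of an almost minimiser at [x] cannot lower the energy by
   more than [d]; this replaces the Euler-Lagrange equation at [x]. *)
Lemma almost_minimizer_row V f d x :
  (forall g, finsupp g -> 0 <= renergy V g) ->
  finsupp f -> (forall y, 0 <= f y) -> renergy V f <= d ->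
  f x * rsum (fun y => b x y * f y `^ (p - 1)) <=
  2 `^ (p - 1) * (d + ((1 + 2 `^ p) * rsum (b x) + 2 `^ p * `|V x|) * f x `^ p).
Proof.
move=> V_ge0 ff f0 fd; set s := f x; set g := bump x s f.
have s0 : 0 <= s by exact: f0.
have fg : finsupp g by exact: finsupp_bump.
have sR : summ (fun y => b x y * f y `^ (p - 1)).
  by apply: (summ_vertex_finsupp ff) => y ->; rewrite powq0 mulr0.
pose k (y : X) := ((1 + 2 `^ p) * s `^ p) * b x y -
  (2 `^ (1 - p) * s) * (b x y * f y `^ (p - 1)).
have sk : summ k by apply: summB; exact: summZ.
have gx : g x = 2 * s by rewrite /g /bump eqxx mulr_natl mulr2n.
have gE y : y != x -> g y = f y by rewrite /g /bump => /negPf ->.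
have vert : rsum (vertex_density V g) - rsum (vertex_density V f) =
    V x * (2 `^ p - 1) * s `^ p.
  rewrite -rsumB; [|exact: summ_vertex|exact: summ_vertex].
  have [_ ->] := @rsum_seq _ _ (fun y => vertex_density V g y - vertex_density V f y)
    [:: x] isT (fun y => ltac:(rewrite inE => yx;
      by rewrite /vertex_density gE// subrr)).
  rewrite big_seq1 /vertex_density gx normrM !ger0_norm// powRM//; ring.
have edges : rsum (edge_density g) - rsum (edge_density f) <= 2 * rsum k.
  rewrite -rsumB; [|exact: summ_edge|exact: summ_edge].
  have := @rsum_edges_le _ _ [:: x] (fun _ => k)
    (fun e => edge_density g e - edge_density f e) isT.
  rewrite big_seq1; apply => //.
    by apply: summB; exact: summ_edge.
  have step z : b x z * `|2 * s - f z| `^ p - b x z * `|s - f z| `^ p <= k z.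
    rewrite -mulrBr; have := powR_double_step p_gt1 s0 (f0 z).
    by move=> /(ler_wpM2l (b_ge0 x z)) /le_trans; apply; rewrite /k le_eqVlt;
      apply/orP; left; apply/eqP; ring.
  move=> y z; rewrite !inE /edge_density/=.
  have [->|yx] := eqVneq y x; have [->|zx] := eqVneq z x.
  - by rewrite /k b_diag !(mul0r, mulr0, subrr, addr0).
  - by rewrite addr0 gx gE//; exact: step.
  - by rewrite add0r gx gE// bC distrC [X in _ - _ * X `^ _]distrC; exact: step.
  - by rewrite !gE// subrr addr0.
have kE : rsum k = (1 + 2 `^ p) * s `^ p * rsum (b x) -
    2 `^ (1 - p) * s * rsum (fun y => b x y * f y `^ (p - 1)).
  by rewrite /k rsumB ?rsumZ//; exact: summZ.
have := V_ge0 g fg; move: fd edges vert; rewrite kE /renergy.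
move: (rsum (fun y => b x y * f y `^ (p - 1))) (rsum (edge_density g))
  (rsum (edge_density f)) (rsum (vertex_density V g))
  (rsum (vertex_density V f)) => rR Eg Ef Vg Vf fd edges vert g0.
have VV : V x * (2 `^ p - 1) * s `^ p <= `|V x| * 2 `^ p * s `^ p.
  have h2 : 1 <= (2 : R) `^ p by rewrite -[leLHS](powRr0 2) ler_powR// ler1n.
  rewrite ler_wpM2r ?powR_ge0// (@le_trans _ _ (`|V x| * (2 `^ p - 1)))//.
    by rewrite ler_wpM2r ?subr_ge0// ler_norm.
  by rewrite ler_wpM2l// lerBlDr lerDl.
have two : (2 : R) `^ (1 - p) = (2 `^ (p - 1))^-1 by rewrite -powRN opprB.
have t0 : 0 < (2 : R) `^ (p - 1) by rewrite powR_gt0.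
rewrite -ler_pdivrMl//.
have -> : (2 `^ (p - 1))^-1 * (s * rR) = 2 `^ (1 - p) * s * rR by rewrite two mulrA.
have -> : ((1 + 2 `^ p) * rsum (b x) + 2 `^ p * `|V x|) * s `^ p =
  (1 + 2 `^ p) * s `^ p * rsum (b x) + `|V x| * 2 `^ p * s `^ p by ring.
lra.
Qed.

(** The inequality for [u] off [s] is tested with [eta], nonnegative on the finite set [T'] where
    truncation acts; [T'] avoids [s] because [f <= u] there. Picone's inequality bounds the change
    on each edge by its share of this test. *)
Lemma renergy_min_le V u s f : (forall x, 0 < u x) ->
  (forall x, summ (fun y => b x y * `|u x - u y| `^ (p - 1))) ->
  (forall x, x \notin s ->
    0 <= rsum (fun y => b x y * spow p (u x - u y)) + V x * u x `^ (p - 1)) ->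
  finsupp f -> (forall x, 0 <= f x) -> (forall x, x \in s -> f x <= u x) ->
  renergy V (fun x => Num.min (f x) (u x)) <= renergy V f.
Proof.
move=> u0 uF u_super ff f0 fu.
have [T uT fT] := ff; pose T' := [seq x <- T | u x < f x].
have uT' : uniq T' by exact: filter_uniq.
pose v x := Num.min (f x) (u x); rewrite -/v.
have fv : finsupp v.
  by apply: finsupp_le ff => x fx; rewrite /v fx min_l// ltW.
have inT' x : x \in T' -> u x < f x by rewrite mem_filter => /andP[].
have outT' x : x \notin T' -> f x <= u x.
  rewrite mem_filter negb_and => /orP[|/fT ->]; last exact: ltW.
  by rewrite -leNgt.
have vin x : x \in T' -> v x = u x by move=> /inT' h; rewrite /v min_r// ltW.
have vout x : x \notin T' -> v x = f x by move=> /outT' h; rewrite /v min_l.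
pose eta x := f x `^ p / u x `^ (p - 1) - u x.
have up x : 0 < u x `^ (p - 1) by exact: powR_gt0.
have etaE x : u x `^ (p - 1) * eta x = f x `^ p - u x `^ p.
  rewrite /eta mulrBr mulrC divfK ?gt_eqF//; congr (_ - _).
  by rewrite mulrC mulr_powRB1// ltW.
have eta0 x : x \in T' -> 0 <= eta x.
  move=> /inT' uf; rewrite -(pmulr_rge0 _ (up x)) etaE subr_ge0.
  by rewrite ge0_ler_powR ?nnegrE// ltW.
have sJ x : summ (fun y => b x y * spow p (u x - u y)).
  apply: le_summ (uF x) => y; rewrite normrM norm_spow//.
  by rewrite ger0_norm.
pose k x y := - eta x * (b x y * spow p (u x - u y)).
have edges : rsum (edge_density v) - rsum (edge_density f) <=
    2 * \sum_(x <- T') rsum (k x).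
  rewrite -rsumB; [|exact: summ_edge|exact: summ_edge].
  apply: rsum_edges_le => //; first by move=> x _; exact: summZ.
    by apply: summB; exact: summ_edge.
  (* An edge leaving [T']: at [y] the function keeps the value [f y <= u y], and monotonicity of
     [spow] replaces [f y] by [u y]. *)
  have mixed x y : x \in T' -> y \notin T' ->
      `|u x - f y| `^ p - `|f x - f y| `^ p <= - eta x * spow p (u x - u y).
    move=> xT yT; have := picone_diag p_gt1 (f0 x) (u0 x) (f0 y).
    have -> : f x `^ p / u x `^ (p - 1) - f y = eta x + (u x - f y).
      by rewrite /eta; ring.
    rewrite mulrDr spow_mul//.
    have : eta x * spow p (u x - u y) <= eta x * spow p (u x - f y).
      by rewrite ler_wpM2l ?eta0// le_spow// lerB// outT'.
    lra.
  move=> x y; rewrite /edge_density/= -mulrBr.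
  have [xT|xT] := boolP (x \in T'); have [yT|yT] := boolP (y \in T').
  - rewrite !vin// /k (bC y) -(opprB (u x)) spowN.
    have := picone p_gt1 (f0 x) (f0 y) (u0 x) (u0 y).
    have -> : f x `^ p / u x `^ (p - 1) - f y `^ p / u y `^ (p - 1) =
        eta x - eta y + (u x - u y) by rewrite /eta; ring.
    rewrite mulrDr spow_mul// => h.
    have -> : - eta x * (b x y * spow p (u x - u y)) +
        - eta y * (b x y * - spow p (u x - u y)) =
        b x y * - (spow p (u x - u y) * (eta x - eta y)) by ring.
    by rewrite ler_wpM2l//; lra.
  - by rewrite addr0 vin// vout// /k mulrCA ler_wpM2l// mixed.
  - rewrite add0r vout// vin// /k (bC y) mulrCA ler_wpM2l// distrC.
    by rewrite [X in _ - X `^ _]distrC mixed.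
  - by rewrite !vout// subrr mulr0 addr0.
have kE x : rsum (k x) = - eta x * rsum (fun y => b x y * spow p (u x - u y)).
  by rewrite rsumZ.
(* The vertex terms match exactly, since [u^(p-1) * eta = f^p - u^p]. *)
have vert : rsum (vertex_density V v) - rsum (vertex_density V f) =
    \sum_(x <- T') (- eta x * (V x * u x `^ (p - 1))).
  rewrite -rsumB; [|exact: summ_vertex|exact: summ_vertex].
  have vout0 x : x \notin T' -> vertex_density V v x - vertex_density V f x = 0.
    by move=> xT; rewrite /vertex_density vout// subrr.
  have [_ ->] := rsum_seq uT' vout0.
  rewrite !big_seq; apply: eq_bigr => x xT; rewrite /vertex_density vin//.
  rewrite !ger0_norm ?(ltW (u0 x))// mulrCA mulNr [eta x * _]mulrC etaE; ring.
have tot : \sum_(x <- T') rsum (k x) +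
    \sum_(x <- T') (- eta x * (V x * u x `^ (p - 1))) <= 0.
  rewrite -big_split/= big_seq; apply: sumr_le0 => x xT.
  rewrite kE -mulrDr mulNr oppr_le0 mulr_ge0 ?eta0// u_super//.
  by apply: contraL xT => /fu; rewrite mem_filter => /le_gtF ->.
rewrite /renergy -subr_le0.
rewrite opprD addrACA -mulrBr.
rewrite vert; apply: le_trans tot; rewrite lerD2r ler_pdivrMl//.
Qed.

(** * Convexity and limits of the energy *)

Lemma renergy_ge0 V f : (forall x, 0 <= V x) -> 0 <= renergy V f.
Proof.
move=> V0; apply: addr_ge0; first by rewrite mulr_ge0// rsum_ge0.
by apply: rsum_ge0 => x; rewrite mulr_ge0// powR_ge0.
Qed.

Lemma edge_densityN f : edge_density (fun x => - f x) = edge_density f.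
Proof.
apply/funext => e; rewrite /edge_density; congr (_ * _ `^ _).
by rewrite -normrN; congr `|_|; ring.
Qed.

Lemma vertex_densityN V f : vertex_density V (fun x => - f x) = vertex_density V f.
Proof. by apply/funext => x; rewrite /vertex_density normrN. Qed.

Lemma renergy_uniform_convex V e : (forall x, 0 <= V x) -> 0 < e ->
  exists2 C, 0 <= C & forall f g, finsupp f -> finsupp g ->
    renergy V (fun x => f x - g x) <= e * (renergy V f + renergy V g) +
      C * ((renergy V f + renergy V g) / 2 - renergy V (fun x => (f x + g x) / 2)).
Proof.
have comb (d C a1 a2 a3 a4 b1 b2 b3 b4 : R) :
    a3 <= d * (a1 + a2) + C * ((a1 + a2) / 2 - a4) ->
    b3 <= d * (b1 + b2) + C * ((b1 + b2) / 2 - b4) ->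
    2^-1 * a3 + b3 <= d * (2^-1 * a1 + b1 + (2^-1 * a2 + b2)) +
      C * ((2^-1 * a1 + b1 + (2^-1 * a2 + b2)) / 2 - (2^-1 * a4 + b4)).
  by lra.
move=> V0 /(powR_uniform_convex p_gt1)[C C0 HC]; exists C => // f g ff fg.
have fsub : finsupp (fun x => f x - g x).
  by apply: finsuppD => //; apply: finsupp_le fg => x ->; rewrite oppr0.
have fmid : finsupp (fun x => (f x + g x) / 2).
  by apply: finsupp_le (finsuppD ff fg) => x ->; rewrite mul0r.
have dens (I : countType) (F G S M : I -> R) :
    summ F -> summ G -> summ S -> summ M ->
    (forall i, S i <= e * (F i + G i) + C * ((F i + G i) / 2 - M i)) ->
    rsum S <= e * (rsum F + rsum G) + C * ((rsum F + rsum G) / 2 - rsum M).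
  move=> sF sG sS sM le; have sFG := summD sF sG.
  rewrite -!rsumD// -rsumZ// [_ / 2]mulrC -(rsumZ 2^-1)//.
  have sH := summZ 2^-1 sFG; rewrite -rsumB// -(rsumZ C); last exact: summB.
  have sB := summZ C (summB sH sM); rewrite -rsumD//; last exact: summZ.
  apply: le_rsum => //; first by apply: summD => //; exact: summZ.
  by move=> i; rewrite [2^-1 * _]mulrC.
have he := dens _ _ _ _ _ (summ_edge ff) (summ_edge fg) (summ_edge fsub)
  (summ_edge fmid).
have hv := dens _ _ _ _ _ (summ_vertex V ff) (summ_vertex V fg)
  (summ_vertex V fsub) (summ_vertex V fmid).
apply: comb; [apply: he => -[x y]|apply: hv => x].
  rewrite /edge_density/=.
  have := ler_wpM2l (b_ge0 x y) (HC (f x - f y) (g x - g y)).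
  have -> : f x - g x - (f y - g y) = f x - f y - (g x - g y) by ring.
  have -> : (f x + g x) / 2 - (f y + g y) / 2 =
    (f x - f y + (g x - g y)) / 2 by ring.
  move=> /le_trans; apply; rewrite le_eqVlt; apply/orP; left; apply/eqP; ring.
rewrite /vertex_density.
have := ler_wpM2l (V0 x) (HC (f x) (g x)).
move=> /le_trans; apply; rewrite le_eqVlt; apply/orP; left; apply/eqP; ring.
Qed.

Lemma cvg_edge_density (v : nat -> X -> R) f e :
  (forall x, v n x @[n --> \oo] --> f x) ->
  edge_density (v n) e @[n --> \oo] --> edge_density f e.
Proof.
move=> vf; apply: cvgMl_tmp; apply: cvg_powR_norm => //.
exact: cvgB (vf _) (vf _).
Qed.

Lemma cvg_vertex_density V (v : nat -> X -> R) f x :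
  (forall x, v n x @[n --> \oo] --> f x) ->
  vertex_density V (v n) x @[n --> \oo] --> vertex_density V f x.
Proof. by move=> vf; apply: cvgMl_tmp; exact: cvg_powR_norm. Qed.

Lemma renergy_fatou V (v : nat -> X -> R) f M : (forall x, 0 <= V x) ->
  (forall n, summ (edge_density (v n))) ->
  (forall n, summ (vertex_density V (v n))) ->
  (forall x, v n x @[n --> \oo] --> f x) ->
  (\forall n \near \oo, renergy V (v n) <= M) ->
  [/\ summ (edge_density f), summ (vertex_density V f) & renergy V f <= M].
Proof.
move=> V0 se sv vf vM.
have vd0 g x : 0 <= vertex_density V g x by rewrite mulr_ge0// powR_ge0.
have [||||||| sE sV le] := @fatou_rsum R _ _
  (fun n e => 2^-1 * edge_density (v n) e) (fun n => vertex_density V (v n))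
  (fun e => 2^-1 * edge_density f e) (vertex_density V f) M.
- by move=> n e; rewrite mulr_ge0.
- by move=> n; exact: vd0.
- by move=> n; exact: summZ.
- by [].
- by move=> e; apply: cvgMl_tmp; exact: cvg_edge_density.
- by move=> x; exact: cvg_vertex_density.
- by apply: filterS vM => n; rewrite /renergy rsumZ.
have sf : summ (edge_density f).
  by apply: eq_summ (summZ 2 sE) => e; rewrite mulVKf.
by split => //; rewrite /renergy -rsumZ.
Qed.

(* Mazur's lemma by hand: [A n], the finitely supported functions close to [f]
   at the first [n] points, is convex, so almost minimisers of the energy over
   [A n] form a Cauchy sequence by uniform convexity. *)
Lemma renergy_mazur V (v : nat -> X -> R) f M : (forall x, 0 <= V x) ->
  (forall n, finsupp (v n)) -> (forall n, renergy V (v n) <= M) ->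
  (forall x, v n x @[n --> \oo] --> f x) ->
  exists w : nat -> X -> R, [/\ forall n, finsupp (w n),
    forall x, w n x @[n --> \oo] --> f x,
    \forall n \near \oo, summ (edge_density (fun x => w n x - f x)) /\
                         summ (vertex_density V (fun x => w n x - f x)) &
    renergy V (fun x => w n x - f x) @[n --> \oo] --> 0].
Proof.
have arith (a1 a2 c D r : R) : a1 <= D + r -> a2 <= D + r -> D - r <= c ->
  (a1 + a2) / 2 - c <= 2 * r by lra.
move=> V0 fv vM vf; set E := renergy V.
pose A n := [set w | finsupp w /\ forall x, (pickle x < n)%N ->
  `|w x - f x| <= n.+1%:R^-1].
have A_mono n m : (n <= m)%N -> A m `<=` A n.
  move=> nm w [fw wf]; split => // x xn.
  rewrite (le_trans (wf x (leq_trans xn nm)))//.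
  by rewrite lef_pV2 ?posrE// ler_nat ltnS.
have A_mid n w1 w2 : A n w1 -> A n w2 -> A n (fun x => (w1 x + w2 x) / 2).
  move=> [f1 c1] [f2 c2]; split.
    by apply: finsupp_le (finsuppD f1 f2) => x ->; rewrite mul0r.
  move=> x xn; have := c1 x xn; have := c2 x xn.
  rewrite !ler_norml; move: (n.+1%:R^-1) => r.
  by move=> /andP[? ?] /andP[? ?]; apply/andP; split; lra.
have A_v n : exists k, A n (v k).
  have : \forall k \near \oo, forall x, (pickle x < n)%N ->
      `|v k x - f x| <= n.+1%:R^-1.
    apply: filter_pickle => x.
    have := vf x => /cvgrPdist_le /(_ n.+1%:R^-1).
    rewrite invr_gt0 ltr0n => /(_ isT); apply: filterS => k /=.
    by rewrite distrC.
  by move=> /filter_ex[k vk]; exists k; split; [exact: fv|].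
pose d n := inf [set E w | w in A n].
have lbA n : has_inf [set E w | w in A n].
  split; first by have [k Ak] := A_v n; exists (E (v k)); exists (v k).
  by exists 0 => _ [w _ <-]; exact: renergy_ge0.
have dM n : d n <= M.
  have [k Ak] := A_v n; apply: le_trans (vM k).
  by apply: ge_inf; [exact: (lbA n).2|exists (v k)].
have /choice[w wA] : forall n, exists w, A n w /\ E w <= d n + n.+1%:R^-1.
  move=> n; have n0 : 0 < n.+1%:R^-1 :> R by rewrite invr_gt0.
  by have [_ [w Aw <-] /ltW wd] := inf_adherent n0 (lbA n); exists w.
have fw n : finsupp (w n) by have [[]] := wA n.
have wf x : w n x @[n --> \oo] --> f x.
  apply/cvgrPdist_le => e e0; near=> n.
  have [[_ /(_ x)]] := wA n.
  have xn : (pickle x < n)%N by near: n; exact: nbhs_infty_gt.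
  move=> /(_ xn); rewrite distrC => + _ => /le_trans; apply.
  by apply: ltW; near: n; exact: near_infty_natSinv_lt (PosNum e0).
have M0 : 0 <= M by apply: le_trans (vM 0%N); exact: renergy_ge0.
have cauchy e : 0 < e -> exists N, forall n m, (N <= n)%N -> (N <= m)%N ->
    E (fun x => w n x - w m x) <= e.
  move=> e0.
  (* The almost minimisers have energy at most [M + 1], so this weight costs at most [e / 2]. *)
  have e1 : 0 < e / (4 * (M + 1)) by rewrite divr_gt0// mulr_gt0// ltr_wpDl.
  have [C C0 HC] := renergy_uniform_convex V0 e1.
  have supd : has_sup (range d).
    by split; [exists (d 0%N); exists 0%N|exists M => _ [n _ <-]].
  have C1 : 0 < C + 1 by rewrite ltr_wpDl.
  (* The convexity defect will be at most [2 * r], and so contribute at most [e / 2]. *)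
  pose r := e / (4 * (C + 1)).
  have r0 : 0 < r by rewrite divr_gt0// mulr_gt0.
  have [_ [N0 _ <-] dN0] := sup_adherent r0 supd.
  have [N1 _ N1r] := near_infty_natSinv_lt (PosNum r0).
  exists (maxn N0 N1) => n m; rewrite !geq_max => /andP[n0 n1] /andP[m0 m1].
  have dsup k : d k <= sup (range d) by apply: ub_le_sup; [exact: supd.2|exists k].
  have wle k : (N1 <= k)%N -> E (w k) <= sup (range d) + r.
    move=> k1; have [_ /le_trans] := wA k; apply; apply: lerD => //.
    exact/ltW/N1r.
  have wM k : E (w k) <= M + 1.
    have [_ /le_trans] := wA k; apply; apply: lerD => //.
    by rewrite invf_le1 ?ler1n.
  (* [A] decreases, so the midpoint lies in [A N0], whose infimum is already within [r] of the
     supremum of all infima. *)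
  have mid : sup (range d) - r <= E (fun x => (w n x + w m x) / 2).
    apply: le_trans (ltW dN0) _; apply: ge_inf; first exact: (lbA _).2.
    exists (fun x => (w n x + w m x) / 2) => //; apply: A_mid.
      exact: A_mono n0 _ (wA n).1.
    exact: A_mono m0 _ (wA m).1.
  apply: le_trans (HC _ _ (fw n) (fw m)) _; rewrite -/E.
  have h1 : e / (4 * (M + 1)) * (E (w n) + E (w m)) <= e / 2.
    have -> : e / 2 = e / (4 * (M + 1)) * ((M + 1) + (M + 1)).
      by field; rewrite gt_eqF// ltr_wpDl.
    by rewrite ler_wpM2l ?(ltW e1)// lerD.
  have h2 : C * ((E (w n) + E (w m)) / 2 -
      E (fun x => (w n x + w m x) / 2)) <= e / 2.
    apply: (@le_trans _ _ (C * (2 * r))).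
      by rewrite ler_wpM2l//; exact: arith (wle n n1) (wle m m1) mid.
    rewrite /r (_ : C * _ = e / 2 * (C / (C + 1))); last by field; rewrite gt_eqF.
    by rewrite ger_pMr ?divr_gt0// ler_pdivrMr// mul1r lerDl.
  by have := lerD h1 h2; rewrite -splitr.
have diff_fin n m : finsupp (fun x => w n x - w m x).
  by apply: finsuppD => //; apply: finsupp_le (fw m) => x ->; rewrite oppr0.
(* Fatou in [m] turns the Cauchy estimate into one for [w n - f], together with summability of its
   densities. *)
have limit e n N : (forall m, (N <= m)%N -> E (fun x => w n x - w m x) <= e) ->
    [/\ summ (edge_density (fun x => w n x - f x)),
        summ (vertex_density V (fun x => w n x - f x)) &
        E (fun x => w n x - f x) <= e].
  move=> H; apply: (@renergy_fatou V (fun m x => w n x - w m x)) => //.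
  - by move=> m; exact: summ_edge.
  - by move=> m; exact: summ_vertex.
  - by move=> x; apply: cvgB; [exact: cvg_cst|exact: wf].
  - by exists N.
exists w; split => //.
  have [N HN] := cauchy 1 ltr01.
  by exists N => // n Nn; have [] := limit _ _ _ (fun m => HN n m Nn).
apply/cvgrPdist_le => e /cauchy[N HN]; exists N => // n /= Nn.
have [_ _ le] := limit _ _ _ (fun m => HN n m Nn).
by rewrite sub0r normrN ger0_norm//; exact: renergy_ge0.
Unshelve. all: by end_near. Qed.

(** A substitute for Minkowski's inequality: the first constant tends to 1 as [t] tends to 0. *)
Lemma renergy_add_le V f g t : (forall x, 0 <= V x) -> 0 < t -> t < 1 ->
  summ (edge_density f) -> summ (vertex_density V f) ->
  summ (edge_density g) -> summ (vertex_density V g) ->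
  renergy V (fun x => f x + g x) <=
    (1 - t) `^ (1 - p) * renergy V f + t `^ (1 - p) * renergy V g.
Proof.
move=> V0 s0 s1 ef vf eg vg; set A := _ `^ _; set B := t `^ _.
have dens (I : countType) (F G S : I -> R) : summ F -> summ G ->
    (forall i, 0 <= S i) -> (forall i, S i <= A * F i + B * G i) ->
    rsum S <= A * rsum F + B * rsum G.
  move=> sF sG S0 le; rewrite -!rsumZ// -rsumD; [|exact: summZ|exact: summZ].
  have sD := summD (summZ A sF) (summZ B sG).
  apply: le_rsum => //; apply: le_summ sD => i.
  by rewrite ger0_norm ?le.
have conv a c : `|a + c| `^ p <= A * `|a| `^ p + B * `|c| `^ p.
  apply: le_trans (powR_convex p_gt1 s0 s1 (normr_ge0 _) (normr_ge0 _)).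
  by rewrite ge0_ler_powR ?nnegrE ?addr_ge0// ler_normD.
have vd0 h x : 0 <= vertex_density V h x by rewrite mulr_ge0// powR_ge0.
have hE := dens _ _ _ _ ef eg (edge_ge0 (fun x => f x + g x)).
have hV := dens _ _ _ _ vf vg (vd0 (fun x => f x + g x)).
rewrite /renergy !mulrDr addrACA; apply: lerD; last first.
  apply: hV => x; rewrite /vertex_density [A * _]mulrCA [B * _]mulrCA -mulrDr.
  by rewrite ler_wpM2l.
rewrite [A * _]mulrCA [B * _]mulrCA -mulrDr ler_wpM2l//; apply: hE => -[x y].
rewrite /edge_density/= [A * _]mulrCA [B * _]mulrCA -mulrDr ler_wpM2l//.
by rewrite opprD addrACA conv.
Qed.

(** Fatou for the weight along [w n], the energy of [w n = f + (w n - f)] being split by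
    [renergy_add_le]. For fixed [t] the second part vanishes in the limit; only afterwards does [t]
    tend to 0. *)
Lemma hardy_limit Z V (w : nat -> X -> R) f :
  (forall x, 0 <= Z x) -> (forall x, 0 <= V x) ->
  (forall g, finsupp g -> rsum (vertex_density Z g) <= renergy V g) ->
  (forall n, finsupp (w n)) -> (forall x, w n x @[n --> \oo] --> f x) ->
  (\forall n \near \oo, summ (edge_density (fun x => w n x - f x)) /\
                        summ (vertex_density V (fun x => w n x - f x))) ->
  renergy V (fun x => w n x - f x) @[n --> \oo] --> 0 ->
  summ (edge_density f) -> summ (vertex_density V f) ->
  summ (vertex_density Z f) /\ rsum (vertex_density Z f) <= renergy V f.
Proof.
move=> Z0 V0 hardy fw wf sw Ew ef vf.
have zd0 g x : 0 <= vertex_density Z g x by rewrite mulr_ge0// powR_ge0.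
have bound t e : 0 < t -> t < 1 -> 0 < e -> summ (vertex_density Z f) /\
    rsum (vertex_density Z f) <= (1 - t) `^ (1 - p) * renergy V f + e.
  move=> s0 s1 e0.
  have z0 : summ (fun _ : X => 0 : R) /\ rsum (fun _ : X => 0 : R) = 0.
    by have := @rsum_seq R X (fun=> 0) [::] isT (fun _ _ => erefl); rewrite big_nil.
  have [||||||| _ sZ] := @fatou_rsum R X X (fun _ _ => 0)
    (fun n => vertex_density Z (w n)) (fun=> 0) (vertex_density Z f)
    ((1 - t) `^ (1 - p) * renergy V f + e).
  - by [].
  - by move=> n; exact: zd0.
  - by move=> _; exact: z0.1.
  - by move=> n; exact: summ_vertex.
  - by move=> x; exact: cvg_cst.
  - by move=> x; exact: cvg_vertex_density.
  - have es0 : 0 < e / t `^ (1 - p) by rewrite divr_gt0// powR_gt0.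
    move/cvgrPdist_le: Ew => /(_ _ es0) Ew.
    apply: filterS (filterI sw Ew) => n [[s1' s2']].
    rewrite sub0r normrN ger0_norm ?renergy_ge0// => En.
    rewrite z0.2 add0r; apply: le_trans (hardy _ (fw n)) _.
    have wE : (fun x => f x + (w n x - f x)) = w n.
      by apply/funext => x; rewrite addrC subrK.
    have := renergy_add_le V0 s0 s1 ef vf s1' s2'; rewrite wE => /le_trans; apply.
    by rewrite lerD2l mulrC -ler_pdivlMr ?powR_gt0.
  by rewrite z0.2 add0r.
have h2 : (0 : R) < 2^-1 /\ 2^-1 < (1 : R) by split; [|rewrite invf_lt1 ?ltr1n].
split; first exact: (bound _ _ h2.1 h2.2 ltr01).1.
set z := rsum _; set E := renergy V f.
have z0 : 0 <= z by exact: rsum_ge0.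
(* By Bernoulli, [1 - p * t <= (1 - t) ^ p <= (1 - t) ^ (p - 1)], so the loss is linear in [t]. *)
have half t : 0 < t -> t < 1 -> (1 - p * t) * z <= E.
  move=> s0 s1; have s1' : 0 < 1 - t by rewrite subr_gt0.
  have : z <= (1 - t) `^ (1 - p) * E.
    by apply/ler_addgt0Pr => e e0; exact: (bound _ _ s0 s1 e0).2.
  have t0 := powR_gt0 (p - 1) s1'.
  rewrite -(opprB p 1) powRN ler_pdivlMl// => h.
  apply: le_trans h; rewrite ler_wpM2r//.
  have := bernoulli_powR p_gt1 (ltW s1').
  have -> : 1 + p * (1 - t - 1) = 1 - p * t by ring.
  move=> /le_trans; apply; rewrite -mulr_powRB1 ?(ltW s1')//.
  by rewrite ger_pMl// lerBlDr lerDl ltW.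
have E0 : 0 <= E by exact: renergy_ge0.
apply/ler_addgt0Pr => e e0.
pose t := Num.min 2^-1 (e / (p * (z + 1))).
have z1 : 0 < z + 1 by rewrite ltr_wpDl.
have s0 : 0 < t by rewrite lt_min h2.1/= divr_gt0// mulr_gt0.
have s1 : t < 1 by rewrite gt_min h2.2.
have := half t s0 s1; rewrite mulrBl mul1r.
have : p * t * z <= e.
  apply: (@le_trans _ _ (t * (p * (z + 1)))).
    by rewrite mulrAC mulrC ler_wpM2l ?(ltW s0)// ler_wpM2l// lerDl.
  by rewrite -ler_pdivlMr ?mulr_gt0// ge_min lexx orbT.
lra.
Qed.

Lemma summ_vertexD V f phi : summ (vertex_density V f) -> finsupp phi ->
  summ (vertex_density V (fun x => f x + phi x)).
Proof.
move=> vf fphi; have sd : summ (fun x =>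
    vertex_density V (fun x => f x + phi x) x - vertex_density V f x).
  apply: (summ_vertex_finsupp fphi) => x phix.
  by rewrite /vertex_density phix addr0 subrr.
by apply: eq_summ (summD vf sd) => x; rewrite addrC subrK.
Qed.

(* Passing to the limit in [renergy V (v n) - o(1) <= renergy V (v n + phi)]:
   the energy differences converge since they are dominated in terms of [u]. *)
Lemma limit_minimizes V u (v : nat -> X -> R) f phi :
  (forall x, summ (fun y => b x y * u y `^ (p - 1))) ->
  (forall n, finsupp (v n)) -> (forall n x, `|v n x| <= u x) ->
  (forall x, v n x @[n --> \oo] --> f x) ->
  (forall g, finsupp g -> 0 <= renergy V g) ->
  (forall e, 0 < e -> \forall n \near \oo, renergy V (v n) <= e) ->
  summ (edge_density f) -> summ (vertex_density V f) -> finsupp phi ->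
  renergy V f <= renergy V (fun x => f x + phi x).
Proof.
move=> u_row fv vu vf V_ge0 Vv ef Vf fphi.
have u0 x : 0 <= u x by exact: le_trans (vu 0%N x).
have [s us phi0] := fphi; pose M := \sum_(x <- s) `|phi x|.
have M0 : 0 <= M by apply: sumr_ge0.
have phiM x : `|phi x| <= M.
  have [xs|/phi0 ->] := boolP (x \in s); last by rewrite normr0.
  by rewrite /M (bigD1_seq x)//= lerDl sumr_ge0.
(* Differences are formed edge by edge: they vanish away from the support of [phi], which is what
   permits a majorant. *)
pose dE g e := edge_density (fun x => g x + phi x) e - edge_density g e.
pose dV g x := vertex_density V (fun x => g x + phi x) x - vertex_density V g x.
(* From [powR_norm_increment] with increment at most [2 * M] and base at most [u x + u y];
   [powR_add_le] then isolates [u y], so that the row sums of [u_row] appear. *)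
pose k x y := p * (2 * M) * 2 `^ (p - 1) *
  ((u x + 2 * M) `^ (p - 1) * b x y + b x y * u y `^ (p - 1)).
pose DE (e : X * X) := (if e.1 \in s then k e.1 e.2 else 0) +
                      (if e.2 \in s then k e.2 e.1 else 0).
have sk x : summ (k x) by apply: summZ; apply: summD => //; exact: summZ.
have sDE : summ DE.
  have [s1 _] := rsum_rows us (fun x _ => sk x).
  by have [s2 _] := rsum_swap s1; exact: summD s1 s2.
have pM0 : 0 <= p * (2 * M) * 2 `^ (p - 1) by rewrite !mulr_ge0// powR_ge0.
have k0 x y : 0 <= k x y.
  by rewrite mulr_ge0// addr_ge0// mulr_ge0// powR_ge0.
have dEle g e : (forall x, `|g x| <= u x) -> `|dE g e| <= DE e.
  move=> gu; case: e => x y; rewrite /dE /DE /edge_density/= -mulrBr.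
  have key z w :
      `|b z w * (`|g z + phi z - (g w + phi w)| `^ p - `|g z - g w| `^ p)| <= k z w.
    have dphi : `|phi z - phi w| <= 2 * M.
      by rewrite (le_trans (ler_normB _ _))// mulr_natl mulr2n lerD.
    have dg : `|g z - g w| <= u z + u w.
      by rewrite (le_trans (ler_normB _ _))// lerD.
    rewrite normrM ger0_norm//.
    have -> : g z + phi z - (g w + phi w) = (g z - g w) + (phi z - phi w) by ring.
    apply: le_trans (ler_wpM2l (b_ge0 z w) (powR_norm_increment p_gt1 _ _)) _.
    have -> : k z w = b z w * (p * (2 * M) *
        (2 `^ (p - 1) * ((u z + 2 * M) `^ (p - 1) + u w `^ (p - 1)))).
      by rewrite /k; ring.
    rewrite ler_wpM2l//; apply: ler_pM; rewrite ?mulr_ge0 ?powR_ge0//.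
      by rewrite ler_wpM2l.
    have uM : 0 <= u z + 2 * M by rewrite addr_ge0// mulr_ge0.
    apply: le_trans (powR_add_le pB1_ge0 uM (u0 w)).
    have le : `|g z - g w| + `|phi z - phi w| <= u z + 2 * M + u w.
      by rewrite addrAC lerD.
    by rewrite ge0_ler_powR ?nnegrE// addr_ge0.
  case: ifPn => xs.
    by apply: le_trans (key x y) _; rewrite lerDl; case: ifP.
  case: ifPn => ys; last first.
    by rewrite (phi0 _ xs) (phi0 _ ys) !addr0 subrr mulr0 normr0.
  rewrite add0r bC distrC [X in _ - X `^ _]distrC; exact: key.
pose DV x := `|V x| * (p * `|phi x| * (u x + `|phi x|) `^ (p - 1)).
have sDV : summ DV.
  apply: (summ_vertex_finsupp fphi) => x phix.
  by rewrite /DV phix normr0 mulr0 mul0r mulr0.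
have dVle g x : (forall x, `|g x| <= u x) -> `|dV g x| <= DV x.
  move=> gu; rewrite /dV /vertex_density -mulrBr normrM ler_wpM2l//.
  apply: le_trans (powR_norm_increment p_gt1 _ _) _.
  rewrite ler_wpM2l ?mulr_ge0//.
  have le : `|g x| + `|phi x| <= u x + `|phi x| by rewrite lerD2r.
  by rewrite ge0_ler_powR ?nnegrE// addr_ge0.
have vphi x : v n x + phi x @[n --> \oo] --> f x + phi x.
  by apply: cvgD; [exact: vf|exact: cvg_cst].
have [sE cE] := @tannery R _ (fun n => dE (v n)) (dE f) DE sDE
  (fun n e => dEle _ e (vu n))
  (fun e => ltac:(by apply: cvgB; exact: cvg_edge_density)).
have [sV cV] := @tannery R _ (fun n => dV (v n)) (dV f) DV sDV
  (fun n x => dVle _ x (vu n))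
  (fun x => ltac:(by apply: cvgB; exact: cvg_vertex_density)).
have cL : 2^-1 * rsum (dE (v n)) + rsum (dV (v n)) @[n --> \oo] -->
    2^-1 * rsum (dE f) + rsum (dV f).
  by apply: cvgD => //; apply: cvgMl_tmp.
(* [renergy V (v n + phi) >= 0] and eventually [renergy V (v n) <= e], so the differences are
   eventually at least [- e]. *)
have L0 : 0 <= 2^-1 * rsum (dE f) + rsum (dV f).
  apply/ler_addgt0Pr => e e0; rewrite -lerBlDr sub0r.
  apply: (cvgr_to_ge cL); apply: filterS (Vv e e0) => n vne.
  have fvp : finsupp (fun x => v n x + phi x) by exact: finsuppD.
  rewrite /dE rsumB; [|exact: summ_edge|exact: summ_edge].
  rewrite /dV rsumB; [|exact: summ_vertex|exact: summ_vertex].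
  have -> : 2^-1 * (rsum (edge_density (fun x => v n x + phi x)) -
        rsum (edge_density (v n))) +
      (rsum (vertex_density V (fun x => v n x + phi x)) -
        rsum (vertex_density V (v n))) =
      renergy V (fun x => v n x + phi x) - renergy V (v n).
    by rewrite /renergy mulrBr addrACA -opprD.
  by rewrite lerBrDl (le_trans _ (V_ge0 _ fvp))// subr_le0.
have sEf : summ (edge_density (fun x => f x + phi x)).
  by apply: eq_summ (summD ef sE) => e; rewrite addrC subrK.
rewrite -subr_ge0; apply: le_trans L0 _.
rewrite /dE rsumB// /dV rsumB//; last exact: summ_vertexD.
by rewrite /renergy mulrBr addrACA -opprD.
Qed.

(** * Minimising sequences under the spectral gap *)

Section SpectralGap.
Variables (c W : X -> R) (l l' : R) (K : seq X).
Hypothesis W_ge0 : forall x, 0 <= W x.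
Hypothesis l_gt0 : 0 < l.
Hypothesis l_lt : l < l'.
Hypothesis K_uniq : uniq K.

Notation weight f := (rsum (vertex_density W f)).

Definition shifted (x : X) := c x - l * W x.

Hypothesis shifted_ge0 : forall f, finsupp f -> 0 <= renergy shifted f.
Hypothesis l_optimal : forall e, 0 < e -> exists f,
  [/\ finsupp f, 0 < weight f & renergy shifted f <= e * weight f].
Hypothesis gap : forall f, finsupp f -> (forall x, x \in K -> f x = 0) ->
  l' * weight f <= renergy c f.

Let weight_ge0 f : 0 <= weight f.
Proof. by apply: rsum_ge0 => x; rewrite mulr_ge0// powR_ge0. Qed.

Let vertexW_ge0 f x : 0 <= vertex_density W f x.
Proof. by rewrite mulr_ge0// powR_ge0. Qed.

Let renergy_shifted f : finsupp f ->
  renergy shifted f = renergy c f - l * weight f.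
Proof.
move=> ff; rewrite renergyB; [|exact: summ_vertex|exact: summ_vertex].
congr (_ - _); rewrite -rsumZ; last exact: summ_vertex.
by apply: eq_rsum => x; rewrite /vertex_density mulrA.
Qed.

(** The gap inequality for [cut K f]: the error of the cut and [l'] times the weight on [K] go to
    the right, and subtracting [l * weight f] turns [Q] into [h]. *)
Lemma gap_weight f : finsupp f -> (forall x, 0 <= f x) ->
  (l' - l) * weight f <= renergy shifted f + \sum_(x <- K)
    (p * f x * rsum (fun y => b x y * f y `^ (p - 1)) +
     (`|c x| + l' * W x) * f x `^ p).
Proof.
move=> ff f0.
have gc : l' * weight (cut K f) <= renergy c (cut K f).
  by apply: gap => [|x xK]; [exact: finsupp_cut|rewrite /cut xK].
have := le_trans gc (renergy_cut c ff K_uniq f0).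
rewrite renergy_shifted// (vertex_cut W ff K_uniq) !big_split/=.
have -> : \sum_(x <- K) (`|c x| + l' * W x) * f x `^ p =
    \sum_(x <- K) `|c x| * f x `^ p + l' * \sum_(x <- K) W x * `|f x| `^ p.
  rewrite mulr_sumr -big_split/=; apply: eq_bigr => x _.
  by rewrite (ger0_norm (f0 x)); ring.
set A := \sum_(x <- K) p * _ * _; set B := \sum_(x <- K) `|c x| * _.
set S := \sum_(x <- K) W x * _; set w := weight _; set Ec := renergy c f.
move: A B S w Ec => A B S w Ec; lra.
Qed.

(** By the row bound, the error in [gap_weight] is at most a small multiple of the weight plus a
    multiple of the charge [S] on [K]. The small part is absorbed on the left, so [S] dominates the
    weight and can replace it as normaliser. *)
Lemma near_minimizers_charge e : 0 < e -> exists f,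
  [/\ finsupp f, forall x, 0 <= f x, 0 < \sum_(x <- K) f x `^ p &
      renergy shifted f <= e * \sum_(x <- K) f x `^ p].
Proof.
have arith (D d N w Es Er C : R) : D * w <= Es + Er -> Er <= N * (d * w) + C ->
    Es <= d * w -> d * (1 + N) * w <= D / 2 * w -> D / 2 * w <= C by lra.
move=> e0; pose t := (2 : R) `^ (p - 1); have t0 : 0 < t by rewrite powR_gt0.
pose A x := p * t * ((1 + 2 `^ p) * rsum (b x) + 2 `^ p * `|shifted x|) +
  (`|c x| + l' * W x).
have l'0 : 0 < l' by exact: lt_trans l_lt.
have A0 x : 0 <= A x.
  have B0 : 0 <= rsum (b x) by exact: rsum_ge0.
  have p2 := powR_ge0 (2 : R) p.
  apply: addr_ge0; last by rewrite addr_ge0// mulr_ge0// ltW.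
  by apply: mulr_ge0; [rewrite mulr_ge0// ltW|
    rewrite addr_ge0// mulr_ge0// addr_ge0].
pose G := \sum_(x <- K) A x.
have G0 : 0 <= G by apply: sumr_ge0.
pose N := \sum_(x <- K) (p * t).
have N0 : 0 <= N by apply: sumr_ge0 => x _; rewrite mulr_ge0// ltW.
pose D := l' - l; have D0 : 0 < D by rewrite subr_gt0.
(* The first bound absorbs [d * (1 + N) * weight f] into half of [D * weight f]; the second turns
   the tolerance [d * weight f] into [e * S]. *)
pose d := Num.min (D / 2 / (1 + N)) (e * D / 2 / (G + 1)).
have N1 : 0 < 1 + N by rewrite ltr_pwDl.
have G1 : 0 < G + 1 by rewrite ltr_wpDl.
have d0 : 0 < d by rewrite lt_min !divr_gt0// mulr_gt0.
have [g [fg wg hg]] := l_optimal d0.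
pose f x := `|g x|; exists f.
have ff : finsupp f by apply: finsupp_le fg => x gx; rewrite /f gx normr0.
have f0 x : 0 <= f x by rewrite /f.
have wE : weight f = weight g.
  by apply: eq_rsum => x; rewrite /vertex_density /f normr_id.
have hf : renergy shifted f <= d * weight f.
  by rewrite wE; apply: le_trans hg; exact: renergy_norm.
rewrite -wE in wg; set S := \sum_(x <- K) _.
have S0 : 0 <= S by apply: sumr_ge0 => x _; exact: powR_ge0.
have err : \sum_(x <- K) (p * f x * rsum (fun y => b x y * f y `^ (p - 1)) +
     (`|c x| + l' * W x) * f x `^ p) <= N * (d * weight f) + G * S.
  rewrite /N /G !mulr_suml -big_split/= !big_seq.
  apply: ler_sum => x xK.
  have fS : f x `^ p <= S.
    by rewrite /S (bigD1_seq x)//= lerDl sumr_ge0// => y _; exact: powR_ge0.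
  apply: (@le_trans _ _ (p * t * (d * weight f) + A x * f x `^ p)); last first.
    by rewrite lerD2l ler_wpM2l.
  have row := ler_wpM2l p_ge0 (almost_minimizer_row x shifted_ge0 ff f0 hf).
  rewrite mulrA -/t in row; apply: le_trans (lerD row (lexx _)) _.
  by rewrite /A le_eqVlt; apply/orP; left; apply/eqP; ring.
have := gap_weight ff f0; rewrite -/D => main.
have d1 : d * (1 + N) <= D / 2 by rewrite -ler_pdivlMr// ge_min lexx.
have d2 : d * (G + 1) <= e * D / 2 by rewrite -ler_pdivlMr// ge_min lexx orbT.
have wS : D / 2 * weight f <= G * S.
  have : d * (1 + N) * weight f <= D / 2 * weight f by rewrite ler_wpM2r// ltW.
  exact: arith main err hf.
have S_gt0 : 0 < S.
  rewrite lt_def S0 andbT; apply/eqP => S00.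
  by move: wS; rewrite S00 mulr0 leNgt mulr_gt0// divr_gt0.
split => //; apply: le_trans hf _.
have D2 : 0 < D / 2 by rewrite divr_gt0.
rewrite -(ler_pM2l D2) mulrCA (@le_trans _ _ (d * (G * S)))//.
  by rewrite ler_wpM2l// ltW.
rewrite (@le_trans _ _ (d * (G + 1) * S))//.
  by rewrite -mulrA ler_wpM2l ?(ltW d0)// ler_wpM2r// lerDl.
by rewrite (le_trans (ler_wpM2r S0 d2))// le_eqVlt; apply/orP; left; apply/eqP; ring.
Qed.

Variable u : X -> R.
Hypothesis u_gt0 : forall x, 0 < u x.
Hypothesis u_row : forall x, summ (fun y => b x y * `|u x - u y| `^ (p - 1)).
Hypothesis u_eq : forall x, x \notin K ->
  rsum (fun y => b x y * spow p (u x - u y)) + shifted x * u x `^ (p - 1) = 0.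
Hypothesis u_neg : summ (vertex_density c^\- u).

(** Dividing by [T] makes the nonnegative ratios [h x / u x] over [K] add up to 1, so each is at
    most 1. Hence [h <= u] on [K], and truncation at [u] preserves the normalisation. *)
Lemma near_minimizers_below e : 0 < e -> exists v,
  [/\ finsupp v, forall x, 0 <= v x <= u x, \sum_(x <- K) v x / u x = 1 &
      renergy shifted v <= e].
Proof.
move=> e0; pose U := \sum_(x <- K) u x `^ p.
have U0 : 0 <= U by apply: sumr_ge0 => x _; exact: powR_ge0.
have U1 : 0 < U + 1 by rewrite ltr_wpDl.
(* After the division by [T] the charge on [K] is at most [U], whence the tolerance
   [e / (U + 1)]. *)
have [f [ff f0 fS fe]] := near_minimizers_charge (divr_gt0 e0 U1).
pose T := \sum_(x <- K) f x / u x.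
have T0 : 0 <= T by apply: sumr_ge0 => x _; rewrite divr_ge0// ltW.
have T_gt0 : 0 < T.
  rewrite lt_def T0 andbT; apply/eqP => /eqP TK0; move: fS.
  suff -> : \sum_(x <- K) f x `^ p = 0 by rewrite ltxx.
  rewrite big_seq; apply: big1 => x xK; move: TK0.
  rewrite psumr_eq0; last by move=> y _; rewrite divr_ge0// ltW.
  move=> /allP /(_ _ xK); rewrite mulf_eq0 invr_eq0 (gt_eqF (u_gt0 x)) orbF.
  by move=> /eqP ->; rewrite powp0.
pose h x := T^-1 * f x.
have h0 x : 0 <= h x by rewrite mulr_ge0// invr_ge0.
have fh : finsupp h by apply: finsupp_le ff => x fx; rewrite /h fx mulr0.
have hK : \sum_(x <- K) h x / u x = 1.
  rewrite (eq_bigr (fun x => T^-1 * (f x / u x))); last first.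
    by move=> x _; rewrite /h mulrA.
  by rewrite -mulr_sumr mulVf// gt_eqF.
have hu x : x \in K -> h x <= u x.
  move=> xK; rewrite -[u x]mul1r -ler_pdivrMr// -hK.
  by rewrite (bigD1_seq x)//= lerDl sumr_ge0// => y _; rewrite divr_ge0// ltW.
pose v x := Num.min (h x) (u x); exists v; split.
- by apply: finsupp_le fh => x hx; rewrite /v hx min_l// ltW.
- by move=> x; rewrite /v le_min h0 ltW//= ge_min lexx orbT.
- rewrite -hK !big_seq; apply: eq_bigr => x xK; rewrite /v min_l//; exact: hu.
apply: (@le_trans _ _ (renergy shifted h)).
  by apply: (@renergy_min_le _ _ K) => // x xK; rewrite u_eq.
rewrite renergyZ// (le_trans (ler_wpM2l (powR_ge0 _ _) fe))//.
rewrite mulrCA mulr_sumr.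
have le : \sum_(x <- K) `|T^-1| `^ p * f x `^ p <= U.
  rewrite /U !big_seq; apply: ler_sum => x xK.
  rewrite -powRM// ge0_ler_powR ?nnegrE ?mulr_ge0// ?(ltW (u_gt0 x))//.
  by rewrite ger0_norm ?invr_ge0//; exact: hu.
rewrite -mulrA ger_pMr// mulrC ler_pdivrMr// mul1r (le_trans le)//.
by rewrite lerDl.
Qed.

(** The formal domain controls differences of [u] only; [u y <= |u x - u y| + u x] and the
    summability of [b x] give the values. *)
Let u_row' x : summ (fun y => b x y * u y `^ (p - 1)).
Proof.
have s1 := summZ (2 `^ (p - 1)) (u_row x).
have s2 := summZ (2 `^ (p - 1) * u x `^ (p - 1)) (b_summ x).
apply: le_summ (summD s1 s2) => y.
rewrite ger0_norm ?mulr_ge0 ?powR_ge0//.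
have -> : 2 `^ (p - 1) * (b x y * `|u x - u y| `^ (p - 1)) +
   2 `^ (p - 1) * u x `^ (p - 1) * b x y =
   b x y * (2 `^ (p - 1) * (`|u x - u y| `^ (p - 1) + u x `^ (p - 1))) by ring.
rewrite ler_wpM2l//; have ux := ltW (u_gt0 x); have uy := ltW (u_gt0 y).
apply: le_trans (powR_add_le pB1_ge0 (normr_ge0 _) ux).
have uyle : u y <= `|u x - u y| + u x.
  by rewrite -lerBlDr (le_trans (ler_norm _))// distrC.
by rewrite ge0_ler_powR ?nnegrE// addr_ge0.
Qed.

(** The error terms of [gap_weight] increase with [v], so [v <= u] bounds the weight by a constant.
    Then [Q_+] is [h] plus [l] times the weight plus the [c^\-] part, which is at most that of
    [u]. *)
Lemma renergy_pos_bounded : exists M, forall v, finsupp v ->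
  (forall x, 0 <= v x <= u x) -> renergy shifted v <= 1 -> renergy c^\+ v <= M.
Proof.
have D0 : 0 < l' - l by rewrite subr_gt0.
pose E := \sum_(x <- K) (p * u x * rsum (fun y => b x y * u y `^ (p - 1)) +
     (`|c x| + l' * W x) * u x `^ p).
exists (1 + l * ((1 + E) / (l' - l)) + rsum (vertex_density c^\- u)).
move=> v fv vu v1; have v0 x : 0 <= v x by case/andP: (vu x).
have vle x : v x <= u x by case/andP: (vu x).
have pw q x : 0 <= q -> v x `^ q <= u x `^ q.
  by move=> q0; rewrite ge0_ler_powR ?nnegrE ?(ltW (u_gt0 x)).
have wv : weight v <= (1 + E) / (l' - l).
  rewrite ler_pdivlMr// mulrC; apply: le_trans (gap_weight fv v0) _.
  apply: lerD => //; apply: ler_sum => x _; apply: lerD.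
    apply: ler_pM; rewrite ?mulr_ge0//.
    - by apply: rsum_ge0 => y; rewrite mulr_ge0// powR_ge0.
    - by rewrite ler_wpM2l.
    apply: le_rsum; [|exact: u_row'|].
      by apply: (summ_vertex_finsupp fv) => y ->; rewrite powq0 mulr0.
    by move=> y; rewrite ler_wpM2l// pw.
  by rewrite ler_wpM2l ?pw// addr_ge0// mulr_ge0// ltW// (lt_trans l_gt0).
have -> : c^\+ = fun x => c x + c^\- x.
  apply/funext => x; apply/eqP; rewrite -subr_eq; apply/eqP.
  by rewrite -[in RHS](funrposBneg c).
rewrite renergyD; [|exact: summ_vertex|exact: summ_vertex].
apply: lerD.
  have -> : renergy c v = renergy shifted v + l * weight v.
    by rewrite renergy_shifted// subrK.
  by apply: lerD => //; rewrite ler_wpM2l// ltW.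
apply: le_rsum => //; first exact: summ_vertex.
move=> x; rewrite /vertex_density ler_wpM2l ?funrneg_ge0//.
by rewrite !ger0_norm ?pw// ltW.
Qed.

Lemma ground_state : exists f, [/\
  summ (edge_density f),
  summ (vertex_density c^\+ f), summ (vertex_density c^\- f),
  summ (vertex_density W f) &
  [/\ exists w : nat -> X -> R, [/\ forall n, finsupp (w n),
        forall x, w n x @[n --> \oo] --> f x,
        \forall n \near \oo, summ (edge_density (fun x => w n x - f x)) /\
                             summ (vertex_density c^\+ (fun x => w n x - f x)) &
        renergy c^\+ (fun x => w n x - f x) @[n --> \oo] --> 0],
      f <> (fun=> 0) & renergy c f = l * weight f]].
Proof.
have cp x : 0 <= c^\+ x by exact: funrpos_ge0.
have cn x : 0 <= c^\- x by exact: funrneg_ge0.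
have cE x : c x = c^\+ x - c^\- x by rewrite -[in LHS](funrposBneg c).
have n0 n : 0 < n.+1%:R^-1 :> R by rewrite invr_gt0.
have /choice[v vP] := fun n => near_minimizers_below (n0 n).
have vu n x : `|v n x| <= u x.
  by have [_ /(_ x)/andP[v0 vu] _ _] := vP n; rewrite ger0_norm.
have [k [f [kn vf]]] := bounded_subsequence vu.
have [M HM] := renergy_pos_bounded.
have fv n : finsupp (v (k n)) by have [] := vP (k n).
have vM n : renergy c^\+ (v (k n)) <= M.
  have [? ? _ le] := vP (k n); apply: HM => //; apply: le_trans le _.
  by rewrite invf_le1 ?ler1n.
have [w [fw wf sw Ew]] := renergy_mazur cp fv vM vf.
have [sE scp _] : [/\ summ (edge_density f), summ (vertex_density c^\+ f) &
    renergy c^\+ f <= M].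
  apply: (@renergy_fatou _ (fun n => v (k n))) => //.
  - by move=> n; exact: summ_edge.
  - by move=> n; exact: summ_vertex.
  - exact: filterE.
(* Now [h = Q_+ - Z] on finitely supported functions, and [hardy_limit] carries [Z <= Q_+] over to
   [f]; it also makes the [W] and [c^\-] parts of [f] summable. *)
pose Z x := l * W x + c^\- x.
have Z0 x : 0 <= Z x by rewrite addr_ge0// mulr_ge0// ltW.
have VE : shifted = fun x => c^\+ x - Z x.
  by apply/funext => x; rewrite /shifted cE /Z; ring.
have Z_hardy g : finsupp g -> rsum (vertex_density Z g) <= renergy c^\+ g.
  move=> fg; have := shifted_ge0 fg; rewrite VE.
  by rewrite (renergyB (summ_vertex _ fg) (summ_vertex _ fg)) subr_ge0.
have [sZ Zle] := hardy_limit Z0 cp Z_hardy fw wf sw Ew sE scp.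
have pow0 x : 0 <= `|f x| `^ p by exact: powR_ge0.
have scn : summ (vertex_density c^\- f).
  apply: le_summ sZ => x; rewrite ger0_norm ?mulr_ge0//.
  by rewrite ler_wpM2r// /Z lerDr mulr_ge0// ltW.
have sW : summ (vertex_density W f).
  apply: eq_summ (summZ l^-1 (le_summ (a := fun x => l * vertex_density W f x) _ sZ)).
    by move=> x; rewrite mulKf// gt_eqF.
  move=> x; rewrite ger0_norm; last by rewrite mulr_ge0// ltW.
  by rewrite /vertex_density mulrA ler_wpM2r// /Z lerDl.
have sV : summ (vertex_density shifted f).
  by apply: eq_summ (summB scp sZ) => x; rewrite VE /vertex_density mulrBl.
exists f; split => //; split; first by exists w.
(* The normalising sum over the finite list [K] passes to the limit, so [f = 0] would give
   [1 = 0]. *)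
- move=> f0.
  have : \sum_(x <- K) v (k n) x / u x @[n --> \oo] --> \sum_(x <- K) f x / u x.
    by apply: cvg_sum_seq => x; apply: cvgMr_tmp; exact: vf.
  have -> : \sum_(x <- K) f x / u x = 0.
    by apply: big1 => x _; rewrite f0 mul0r.
  have -> : (fun n => \sum_(x <- K) v (k n) x / u x) = fun=> 1.
    by apply/funext => n; have [] := vP (k n).
  move=> /(cvg_unique (@Rhausdorff R) (cvg_cst (1 : R)))/eqP.
  by rewrite oner_eq0.
have ge0 : 0 <= renergy shifted f.
  by rewrite VE renergyB// subr_ge0.
have le0 : renergy shifted f <= 0.
  (* With [phi = - w n], minimality gives [h f <= h (f - w n) <= Q_+ (w n - f)], which tends to
     0. *)
  apply: (cvgr_to_ge Ew); apply: filterS sw => n [s1 s2].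
  have fNw : finsupp (fun x => - w n x).
    by apply: finsupp_le (fw n) => x ->; rewrite oppr0.
  have small e : 0 < e -> \forall n \near \oo, renergy shifted (v (k n)) <= e.
    move=> e0; have := near_infty_natSinv_lt (PosNum e0).
    apply: filterS => i /ltW /= ie; have [_ _ _ le] := vP (k i).
    apply: le_trans le (le_trans _ ie).
    by rewrite lef_pV2 ?posrE// ler_nat ltnS kn.
  apply: le_trans (limit_minimizes u_row' fv (fun n => vu (k n)) vf shifted_ge0
    small sE sV fNw) _.
  have wN : (fun x => f x + - w n x) = fun x => - (w n x - f x).
    by apply/funext => x; rewrite opprB.
  rewrite wN /renergy edge_densityN lerD2l vertex_densityN.
  have sV' : summ (vertex_density shifted (fun x => w n x - f x)).
    rewrite -vertex_densityN -wN; exact: summ_vertexD.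
  apply: le_rsum => // x; rewrite /vertex_density ler_wpM2r ?powR_ge0//.
  by rewrite VE gerBl.
have : renergy shifted f = 0 by apply/eqP; rewrite eq_le ge0 le0.
have sc : summ (vertex_density c f).
  by apply: eq_summ (summB scp scn) => x; rewrite /vertex_density -mulrBl -cE.
have slW : summ (vertex_density (fun x => l * W x) f).
  by apply: eq_summ (summZ l sW) => x; rewrite /vertex_density mulrA.
rewrite /shifted (renergyB sc slW) => /eqP; rewrite subr_eq0 => /eqP ->.
by rewrite -rsumZ//; apply: eq_rsum => x; rewrite /vertex_density mulrA.
Qed.

End SpectralGap.
End Energy.

(** * Relation with the extended-real functionals *)

Section Bridge.
Context {R : realType} {X : countType} (p : R) (b : X -> X -> R).
Hypothesis p_gt1 : 1 < p.
Hypothesis b_graph : connected_graph b.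
Implicit Types (f g phi c : X -> R).

Lemma Cc_finsupp A phi : Cc A phi -> finsupp phi.
Proof.
move=> [/finite_fsetP[F FE] _]; exists (finmap.enum_fset F).
  exact: finmap.fset_uniq.
move=> x xF; apply/eqP/negPn/negP => phix; have : [set x | phi x != 0] x by [].
by rewrite FE /= (negPf xF).
Qed.

Lemma finsupp_Cc (s : seq X) phi : finsupp phi -> (forall x, x \in s -> phi x = 0) ->
  Cc (~` [set x | x \in s]) phi.
Proof.
move=> [t ut t0] s0; split.
  apply: (@sub_finite_set _ _ [set x | x \in t]); last exact: finite_seq.
  by move=> x /= phix; apply/negPn/negP => /t0 /eqP; rewrite (negPf phix).
by move=> x /= phix /s0 /eqP; rewrite (negPf phix).
Qed.

Lemma grad_energyE f : summ (edge_density p b f) ->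
  grad_energy p b f = (2^-1 * rsum (edge_density p b f))%:E.
Proof.
move=> sf; rewrite /grad_energy EFinM -rsum_ge0E// => e.
by case: b_graph => b0 _ _ _ _; rewrite mulr_ge0// powR_ge0.
Qed.

Lemma energyE c f : summ (edge_density p b f) -> summ (vertex_density p c f) ->
  energy p b c f = (renergy p b c f)%:E.
Proof. by move=> sE sV; rewrite /energy grad_energyE// /renergy EFinD -usumE. Qed.

Lemma energy_plusE c f :
  summ (edge_density p b f) -> summ (vertex_density p c^\+ f) ->
  energy_plus p b c f = (renergy p b c^\+ f)%:E.
Proof.
move=> sE sV; rewrite /energy_plus grad_energyE// EFinD -rsum_ge0E// => x.
by rewrite mulr_ge0 ?funrpos_ge0// powR_ge0.
Qed.

Lemma weightedE (m g f : X -> R) : (forall x, 0 <= m x) ->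
  summ (vertex_density p (fun x => m x * `|g x|) f) ->
  weighted p m g f = (rsum (vertex_density p (fun x => m x * `|g x|) f))%:E.
Proof.
by move=> m0 sf; rewrite -rsum_ge0E// => x; rewrite !mulr_ge0// powR_ge0.
Qed.

(** The witness [phi] excludes the branch of [supremum] that returns the default 0; in the other
    branch the value is a chosen least upper bound. *)
Lemma hardy_sup_ub m c g A phi : Cc A phi -> energy p b c phi != 0%E ->
  (weighted p m g phi / energy p b c phi <= hardy_sup p m b c g A)%E.
Proof.
move=> Aphi E0; rewrite /hardy_sup /supremum; case: ifPn => [/eqP S0|_].
  have : [set (weighted p m g phi / energy p b c phi)%E | phi in
     [set phi | Cc A phi /\ energy p b c phi != 0%E]]
     (weighted p m g phi / energy p b c phi)%E by exists phi.
  by rewrite S0.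
have [ub _] := xgetPex 0%E (ereal_supremums_neq0
  [set (weighted p m g phi / energy p b c phi)%E | phi in
     [set phi | Cc A phi /\ energy p b c phi != 0%E]]).
by apply: ub; exists phi.
Qed.

Lemma hardy_sup_le m c g A t : (0 <= t)%E ->
  (forall phi, Cc A phi -> energy p b c phi != 0%E ->
    (weighted p m g phi / energy p b c phi <= t)%E) ->
  (hardy_sup p m b c g A <= t)%E.
Proof.
move=> t0 H; rewrite /hardy_sup /supremum; case: ifPn => [//|_].
have [_ lub] := xgetPex 0%E (ereal_supremums_neq0
  [set (weighted p m g phi / energy p b c phi)%E | phi in
     [set phi | Cc A phi /\ energy p b c phi != 0%E]]).
by apply: lub => _ [phi [Aphi E0] <-]; exact: H.
Qed.

Lemma hardy_sup_ge0 m c g A : (forall x, 0 <= m x) ->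
  (forall phi, Cc A phi -> (0 <= energy p b c phi)%E) ->
  (0 <= hardy_sup p m b c g A)%E.
Proof.
move=> m0 E_ge0.
have [[phi [Aphi E0]]|no] := pselect (exists phi, Cc A phi /\ energy p b c phi != 0%E).
  apply: le_trans (hardy_sup_ub m g Aphi E0); rewrite mule_ge0 ?inve_ge0 ?E_ge0//.
  by apply: esum_ge0 => x _; rewrite lee_fin !mulr_ge0// powR_ge0.
rewrite /hardy_sup [X in supremum _ X](_ : _ = set0) ?supremum0//.
by apply/seteqP; split => // ? [phi Aphi _]; apply: no; exists phi.
Qed.

End Bridge.

Theorem theorem5p3 (R : realType) (X : countType) (p : R)
    (m : X -> R) (b : X -> X -> R) (c g : X -> R)
    (p_gt1 : 1 < p)
    (X_infinite : infinite_set [set: X])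
    (m_gt0 : forall x, 0 < m x)
    (b_graph : connected_graph b)
    (energy_ge0 : forall phi : X -> R,
       Cc [set: X] phi -> (0 <= energy p b c phi)%E)
    (g_hardy : hardy_weights p m b c g)
    (gap : (lambda0 p m b c g < lambda_infty p m b c g)%E)
    (K_u : exists K : set X, finite_set K /\
       exists u : X -> R,
         [/\ formal_domain p b u,
             forall x, 0 < u x,
             forall x, x \notin K ->
               (schrodinger p m b c u x
                - lambda0 p m b c g *
                  (`|g x| * `|u x| `^ (p - 2) * u x)%:E = 0)%E
           & (\esum_(x in [set: X]) (c^\- x * `|u x| `^ p)%:E < +oo)%E]) :
  exists f : X -> R,
    [/\ D0 p b c f,
        f <> (fun=> 0)
      & (hardy_norm p m b c g * energy p b c f = weighted p m g f)%E].
Proof.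
have p_gt0 : 0 < p by exact: lt_trans p_gt1.
have b_ge0 x y : 0 <= b x y by case: b_graph.
have m_ge0 x : 0 <= m x by exact: ltW.
pose W x := m x * `|g x|.
have W_ge0 x : 0 <= W x by rewrite mulr_ge0.
pose wt f := rsum (vertex_density p W f); pose Q f := renergy p b c f.
have eE f : finsupp f -> energy p b c f = (Q f)%:E.
  by move=> ff; rewrite energyE//; [exact: summ_edge|exact: summ_vertex].
have wE f : finsupp f -> weighted p m g f = (wt f)%:E.
  by move=> ff; rewrite weightedE//; exact: summ_vertex.
have CcT (f : X -> R) : finsupp f -> Cc [set: X] f.
  move=> ff; have [fin _] := @finsupp_Cc R X [::] f ff (fun x => ltac:(by [])).
  by split.
have Q_ge0 f : finsupp f -> 0 <= Q f.
  by move=> ff; rewrite -lee_fin -eE// energy_ge0//; exact: CcT.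
have wt_ge0 f : 0 <= wt f by apply: rsum_ge0 => x; rewrite mulr_ge0// powR_ge0.
have [C [C0 HC]] := g_hardy.
have hardyC f : finsupp f -> C * wt f <= Q f.
  by move=> ff; rewrite -lee_fin EFinM -wE// -eE// HC//; exact: CcT.
have quot f : finsupp f -> energy p b c f != 0%E ->
    0 < Q f /\ (weighted p m g f / energy p b c f)%E = (wt f / Q f)%:E.
  move=> ff; rewrite eE// wE// eqe => Q0.
  by rewrite lt_def Q0 Q_ge0// inver (negPf Q0) EFinM.
(* The suprema skip functions of zero energy; the Hardy constant [C] gives these zero weight, so the
   inequalities extend to them. *)
have wt0 f : finsupp f -> Q f = 0 -> wt f = 0.
  move=> ff Q0; apply/eqP; rewrite eq_le wt_ge0 andbT.
  by have := hardyC f ff; rewrite Q0 pmulr_rle0.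
set N := hardy_norm p m b c g.
have N_ge0 : (0 <= N)%E by apply: hardy_sup_ge0.
have N_le : (N <= C^-1%:E)%E.
  apply: hardy_sup_le; first by rewrite lee_fin invr_ge0 ltW.
  move=> f /Cc_finsupp ff E0; have [Q0 ->] := quot f ff E0.
  by rewrite lee_fin ler_pdivrMr// ler_pdivlMl// hardyC.
have [r Nr] : exists r, N = r%:E.
  by move: N_ge0 N_le; case: N => [r| |]//; exists r.
have r_ge0 : 0 <= r by rewrite -lee_fin -Nr.
have Ninf_ge0 : (0 <= hardy_norm_infty p m b c g)%E.
  apply: le_ereal_inf_tmp => _ [K finK <-]; apply: hardy_sup_ge0 => // phi Kphi.
  by apply: energy_ge0; apply: CcT; exact: Cc_finsupp Kphi.
(* Inversion reverses the order on [[0, +oo]]; with [Ninf_ge0] the strict gap also yields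
   [N > 0]. *)
have Ninf_lt : (hardy_norm_infty p m b c g < N)%E.
  by move: gap; rewrite /lambda0 /lambda_infty lte_pV2.
have r0 : 0 < r.
  by rewrite -lte_fin -Nr; exact: le_lt_trans Ninf_lt.
have l0E : lambda0 p m b c g = r^-1%:E.
  by rewrite /lambda0 -/N Nr inver gt_eqF.
pose l := r^-1; have l0 : 0 < l by rewrite invr_gt0.
have [_ [K1 /= finK1 <-] sK1] := ereal_inf_lt Ninf_lt.
(* The supremum off [K1] may be 0; the midpoint between it and [r] keeps [l' = s^-1] finite and
   above [l]. *)
have [s [s0 sr sE]] : exists s, [/\ 0 < s, s < r &
    (hardy_sup p m b c g (~` K1) <= s%:E)%E].
  have := @hardy_sup_ge0 R X p b m c g (~` K1) m_ge0 _.
  move=> /(_ (fun phi Kphi => energy_ge0 _ (CcT _ (Cc_finsupp Kphi)))).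
  move: sK1; rewrite Nr; case: (hardy_sup _ _ _ _ _ _) => [t| |]//.
  rewrite lte_fin lee_fin => tr t0; exists ((t + r) / 2).
  by split; rewrite ?lee_fin; lra.
have [K2 [finK2 [u [uF u0 u_eq u_neg]]]] := K_u.
(* The gap off [K1] and the equation off [K2] both persist when the exceptional set grows. *)
have /finite_seqP[K KE] : finite_set (K1 `|` K2) by rewrite finite_setU.
have quot_le f t : finsupp f -> 0 < t ->
    (energy p b c f != 0%E -> (weighted p m g f / energy p b c f <= t%:E)%E) ->
    t^-1 * wt f <= Q f.
  move=> ff t0 H; have [Q0|Q0] := eqVneq (Q f) 0; first by rewrite Q0 wt0// mulr0.
  have E0 : energy p b c f != 0%E by rewrite eE// eqe.
  have [Qf qE] := quot f ff E0; move: (H E0).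
  by rewrite qE lee_fin ler_pdivrMr// -ler_pdivrMl.
have shiftedE f : finsupp f -> renergy p b (shifted c W l) f = Q f - l * wt f.
  move=> ff; rewrite /shifted renergyB; [|exact: summ_vertex|exact: summ_vertex].
  congr (_ - _); rewrite -rsumZ; last exact: summ_vertex.
  by apply: eq_rsum => x; rewrite /vertex_density mulrA.
have shifted_ge0 f : finsupp f -> 0 <= renergy p b (shifted c W l) f.
  move=> ff; rewrite shiftedE// subr_ge0; apply: quot_le => // E0.
  by rewrite -Nr; apply: hardy_sup_ub => //; exact: CcT.
have l_optimal e : 0 < e -> exists f, [/\ finsupp f, 0 < wt f &
    renergy p b (shifted c W l) f <= e * wt f].
  (* Otherwise [Q >= (l + e) W] would hold on test functions, and the norm would be at most
     [(l + e)^-1 < r]. *)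
  move=> e0; apply: contrapT => no.
  have le0 : 0 < (l + e)^-1 by rewrite invr_gt0 addr_gt0.
  suff : (N <= (l + e)^-1%:E)%E.
    by rewrite Nr lee_fin -[r]invrK lef_pV2 ?posrE ?addr_gt0// gerDl leNgt e0.
  apply: hardy_sup_le; first by rewrite lee_fin ltW.
  move=> f /Cc_finsupp ff E0; have [Q0 ->] := quot f ff E0.
  rewrite lee_fin leNgt; apply/negP; rewrite ltr_pdivlMr// ltr_pdivrMl ?addr_gt0//.
  move=> h; apply: no; exists f; split => //.
    by rewrite -(pmulr_rgt0 _ (addr_gt0 l0 e0)) (lt_trans Q0).
  by rewrite shiftedE// lerBlDr -mulrDl addrC ltW.
have K_gap f : finsupp f -> (forall x, x \in undup K -> f x = 0) ->
    s^-1 * wt f <= Q f.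
  move=> ff fK; apply: quot_le => // E0; apply: le_trans sE.
  apply: hardy_sup_ub => //.
  have [fin sub] := @finsupp_Cc R X (undup K) f ff fK.
  split => // x /sub/= xK K1x; apply: xK; rewrite mem_undup.
  have : (K1 `|` K2) x by left.
  by rewrite KE.
have l_lt : l < s^-1 by rewrite ltf_pV2 ?posrE.
have u_row x : summ (fun y => b x y * `|u x - u y| `^ (p - 1)).
  rewrite summ_ge0; first exact: uF.
  by move=> y; rewrite mulr_ge0// powR_ge0.
have u_row' x : summ (fun y => b x y * spow p (u x - u y)).
  apply: le_summ (u_row x) => y; rewrite normrM norm_spow//.
  by rewrite ger0_norm.
have u_eq' x : x \notin undup K ->
    rsum (fun y => b x y * spow p (u x - u y)) +
    shifted c W l x * u x `^ (p - 1) = 0.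
  rewrite mem_undup => xK.
  have xK2 : x \notin K2.
    apply/negP => /set_mem K2x; have : (K1 `|` K2) x by right.
    by rewrite KE /= (negPf xK).
  have := u_eq x xK2; rewrite l0E /schrodinger.
  have -> : (fun y => b x y * `|u x - u y| `^ (p - 2) * (u x - u y)) =
      fun y => b x y * spow p (u x - u y).
    by apply/funext => y; rewrite /spow mulrA.
  have fin (t A B t' D : R) :
    (t%:E * A%:E + B%:E - t'%:E * D%:E = 0)%E -> t * A + B - t' * D = 0 by case.
  rewrite (usumE (u_row' x)) => /fin.
  rewrite -[c x / m x * _ * _]mulrA -[`|g x| * _ * _]mulrA -/(spow p (u x)).
  rewrite spow_ge0E ?(ltW (u0 x))// => h.
  have mx := m_gt0 x.
  (* Multiplying by [m x] turns the equation for [Q'] into the unweighted one with potential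
     [c - l W]. *)
  have := congr1 ( *%R (m x)) h; rewrite mulr0 => <-.
  by rewrite /shifted /W -/l; field; rewrite gt_eqF.
have u_neg' : summ (vertex_density p c^\- u).
  rewrite summ_ge0; first exact: u_neg.
  by move=> x; rewrite mulr_ge0 ?funrneg_ge0// powR_ge0.
have [f [sE' scp scn sW [[w [fw wf sw Ew]] fn0 fE]]] := ground_state p_gt1 b_graph
  W_ge0 l0 l_lt (undup_uniq K) shifted_ge0 l_optimal K_gap u0 u_row u_eq' u_neg'.
have sc : summ (vertex_density p c f).
  apply: eq_summ (summB scp scn) => x; rewrite /vertex_density -mulrBl.
  by rewrite -[in RHS](funrposBneg c).
exists f; split => //.
  split; first by rewrite /D /= energy_plusE// ltry.
  exists w; split => //; first by move=> n; exact: CcT.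
  have : (renergy p b c^\+ (fun x => w n x - f x))%:E @[n --> \oo] --> 0%:E.
    by apply: cvg_EFin => //; near=> n.
  apply: cvg_trans; apply: near_eq_cvg; apply: filterS sw => n [s1 s2].
  by rewrite energy_plusE.
rewrite -/N Nr energyE// fE weightedE// -EFinM mulrA divff ?gt_eqF// mul1r.
by [].
Unshelve. all: by end_near. Qed.
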